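(* Let $X$, $A$, $\mathcal{F}_p$, $X'$, $F$, $f$, $T$ and $J$ be as in the context. The following hold. (1) If $p\in T-J$, then $\mathcal{F}_p$ is a single point (so $f(p)$ is defined). (2) If $p=(x,y)\in T-J$ lies to the left of $J$, then $$f(p)=\left(\frac{-xy-\sqrt3\,x+\sqrt3\,y^2-y}{\sqrt3\,x+y-2\sqrt3},\;y\right)=\left(\frac{A_yx+B_y}{C_yx+D_y},\;y\right).$$ (3) If $p=(x,y)\in T-J$ lies to the right of $J$, then $$f(p)=\left(\frac{-xy+2\sqrt3\,x+\sqrt3\,y^2-y}{\sqrt3\,x+y+\sqrt3},\;y\right)=\left(\frac{D_yx-B_y}{-C_yx+A_y},\;y\right).$$ (4) If $p$ is the top vertex $\left(\frac14,\frac{\sqrt3}4\right)$ of $T$, then $f(p)=p$. (5) If $p=(x,y)\in J$, then $A(\mathcal{F}_p)$ is the set consisting of the two points given by the formulas in (2) and (3).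
   Context: $X$ is the surface (boundary) of a regular octahedron, scaled to have edge length $\sqrt3$, equipped with its intrinsic metric $d_X$: $d_X(p,q)$ is the length of a shortest path on the surface joining $p$ to $q$. $A:X\to X$ is the antipodal map (restriction to the surface of the central symmetry of the octahedron). For $p\in X$, $\mathcal{F}_p\subset X$ is the set of points $q\in X$ which maximize the function $q\mapsto d_X(p,q)$. $X'\subset X$ is the set of $p$ for which $\mathcal{F}_p$ is a single point; for $p\in X'$, $F(p)$ denotes the unique element of $\mathcal{F}_p$. The map $A$ commutes with $F$, and $f=FA=AF$ on $X'$. Identify $\mathbb{C}=\mathbb{R}^2$. One face $\Delta_0$ of $X$ is identified isometrically with the planar equilateral triangle whose vertices are the three cube roots of unity. $T\subset\Delta_0$ is the closed (solid) triangle with vertices $0$, $1$, $\left(\frac14,\frac{\sqrt3}4\right)$, regarded as a subset of $X$; it is a fundamental domain for the action of the isometry group of $X$. Formulas giving points of $X$ by planar coordinates use this identification of $\Delta_0$ with a face of $X$. $J\subset T$ is the graph of the function $$y=\frac1{\sqrt3}\Bigl(1-x-\bigl((2+x)(5-2x)(1-4x)\bigr)^{1/3}\Bigr),\qquad x\in[r,1/4),$$ where $r\approx 0.239123$ is the root of $x^3-x^2-4x+1$ in $(0,1)$ (so the top endpoint, at $x=1/4$, is not in $J$). Each horizontal line at height $y\in[0,\sqrt3/4)$ meets $J$ in exactly one point; a point $(x,y)\in T-J$ with $y<\sqrt3/4$ lies to the left (resp. right) of $J$ if $x$ is smaller (resp. larger) than the first coordinate of the point of $J$ at height $y$. Notation: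 $A_y=-y-\sqrt3$, $B_y=\sqrt3\,y^2-y$, $C_y=\sqrt3$, $D_y=y-2\sqrt3$. *)

(* Defs.v *)
From Stdlib Require Import Reals Lra Lia Psatz ClassicalEpsilon.
From Coquelicot Require Import Coquelicot.
Open Scope R_scope.

Definition E3 : Type := (R * R * R)%type.

Definition dist3 (p q : E3) : R :=
  let '(p1, p2, p3) := p in
  let '(q1, q2, q3) := q in
  sqrt ((q1 - p1) ^ 2 + (q2 - p2) ^ 2 + (q3 - p3) ^ 2).

(* The vertices of the octahedron are the points [± circumradius * e_i]; the
   value of [circumradius] makes the edges have length [sqrt 3]. *)
Definition circumradius : R := sqrt (3 / 2).

Definition octahedron (p : E3) : Prop :=
  let '(p1, p2, p3) := p in
  Rabs p1 + Rabs p2 + Rabs p3 = circumradius.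

Definition antipode (p : E3) : E3 :=
  let '(p1, p2, p3) := p in (- p1, - p2, - p3).

Definition unit_interval (t : R) : Prop := 0 <= t <= 1.

Definition path_on_octahedron (p q : E3) (g : R -> E3) : Prop :=
  continuous_on unit_interval g /\
  (forall t, unit_interval t -> octahedron (g t)) /\
  g 0 = p /\ g 1 = q.

(* Length of an inscribed polygon with vertices [g (t 0), ..., g (t (S n))]. *)
Definition inscribed_length (g : R -> E3) (s : R) : Prop :=
  exists (n : nat) (t : nat -> R),
    t 0%nat = 0 /\ t (S n) = 1 /\
    (forall i, (i <= n)%nat -> t i <= t (S i)) /\
    s = sum_f_R0 (fun i => dist3 (g (t i)) (g (t (S i)))) n.

(* [p_infty] when [g] is not rectifiable. *)
Definition path_length (g : R -> E3) : Rbar := Lub_Rbar (inscribed_length g).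

Definition dX (p q : E3) : Rbar :=
  Glb_Rbar (fun l : R =>
    exists g, path_on_octahedron p q g /\ path_length g = Finite l).

Definition farthest (p q : E3) : Prop :=
  octahedron q /\ forall q', octahedron q' -> Rbar_le (dX p q') (dX p q).

Definition has_unique_farthest (p : E3) : Prop := exists! q, farthest p q.

(* [F_oct] and [f_oct] are meaningful only at points satisfying
   [has_unique_farthest]; elsewhere the value of [F_oct] is some arbitrary point. *)
Definition F_oct (p : E3) : E3 := epsilon (inhabits (0, 0, 0)) (farthest p).

Definition f_oct (p : E3) : E3 := antipode (F_oct p).

(* The affine map of the plane into space that sends the cube roots of unity
   [1], [(-1/2, sqrt 3/2)], [(-1/2, -sqrt 3/2)] to the three vertices of the
   octahedron on the positive half-axes: the three factors of [circumradius]
   are the barycentric coordinates with respect to the cube roots of unity.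
   It is an isometric embedding, see [chart_isometry], and it meets the
   octahedron exactly in the points coming from the triangle spanned by the
   cube roots of unity, see [chart_octahedron]. *)
Definition chart (p : R * R) : E3 :=
  let '(x, y) := p in
  (circumradius * ((1 + 2 * x) / 3),
   circumradius * ((1 - x + sqrt 3 * y) / 3),
   circumradius * ((1 - x - sqrt 3 * y) / 3)).

(* Solid closed triangle. *)
Definition triangle (u v w p : R * R) : Prop :=
  exists a b c : R,
    0 <= a /\ 0 <= b /\ 0 <= c /\ a + b + c = 1 /\
    p = (a * fst u + b * fst v + c * fst w,
         a * snd u + b * snd v + c * snd w).

Definition Delta0 : R * R -> Prop :=
  triangle (1, 0) (-1 / 2, sqrt 3 / 2) (-1 / 2, - (sqrt 3 / 2)).

Definition T_top : R * R := (1 / 4, sqrt 3 / 4).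

Definition T : R * R -> Prop := triangle (0, 0) (1, 0) T_top.

Definition is_J_root (x : R) : Prop :=
  0 < x < 1 /\ x ^ 3 - x ^ 2 - 4 * x + 1 = 0.

Definition J_root : R := epsilon (inhabits 0) is_J_root.

(* [Rpower _ (1 / 3)] is the cube root only for a positive argument; here the
   argument is positive since [0 < x < 1 / 4]. *)
Definition J_fun (x : R) : R :=
  / sqrt 3 *
  (1 - x - Rpower ((2 + x) * (5 - 2 * x) * (1 - 4 * x)) (1 / 3)).

Definition J (p : R * R) : Prop :=
  J_root <= fst p < 1 / 4 /\ snd p = J_fun (fst p).

Definition left_of_J (p : R * R) : Prop :=
  exists x', J (x', snd p) /\ fst p < x'.

Definition right_of_J (p : R * R) : Prop :=
  exists x', J (x', snd p) /\ x' < fst p.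

Definition coefA (y : R) : R := - y - sqrt 3.
Definition coefB (y : R) : R := sqrt 3 * y ^ 2 - y.
Definition coefC (y : R) : R := sqrt 3.
Definition coefD (y : R) : R := y - 2 * sqrt 3.

Definition left_formula (p : R * R) : R * R :=
  let '(x, y) := p in
  ((- x * y - sqrt 3 * x + sqrt 3 * y ^ 2 - y)
     / (sqrt 3 * x + y - 2 * sqrt 3), y).

Definition left_moebius (p : R * R) : R * R :=
  let '(x, y) := p in
  ((coefA y * x + coefB y) / (coefC y * x + coefD y), y).

Definition right_formula (p : R * R) : R * R :=
  let '(x, y) := p in
  ((- x * y + 2 * sqrt 3 * x + sqrt 3 * y ^ 2 - y)
     / (sqrt 3 * x + y + sqrt 3), y).

Definition right_moebius (p : R * R) : R * R :=
  let '(x, y) := p in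
  ((coefD y * x - coefB y) / (- coefC y * x + coefA y), y).

Lemma sqrt3_sqr : sqrt 3 * sqrt 3 = 3.
Proof. apply sqrt_sqrt; lra. Qed.

Lemma circumradius_sqr : circumradius * circumradius = 3 / 2.
Proof. apply sqrt_sqrt; lra. Qed.

Lemma circumradius_pos : 0 < circumradius.
Proof. apply sqrt_lt_R0; lra. Qed.

Lemma edge_length :
  dist3 (circumradius, 0, 0) (0, circumradius, 0) = sqrt 3.
Proof.
  unfold dist3; f_equal; generalize circumradius_sqr; intros H; nra.
Qed.

Lemma chart_isometry (x y x' y' : R) :
  dist3 (chart (x, y)) (chart (x', y')) =
  sqrt ((x' - x) ^ 2 + (y' - y) ^ 2).
Proof.
  unfold dist3, chart; f_equal.
  transitivity (circumradius * circumradius *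
    (6 * (x' - x) ^ 2 + 2 * (sqrt 3 * sqrt 3) * (y' - y) ^ 2) / 9);
    [field | rewrite circumradius_sqr, sqrt3_sqr; field].
Qed.

Lemma chart_octahedron (p : R * R) : octahedron (chart p) <-> Delta0 p.
Proof.
  destruct p as [x y]; unfold Delta0, triangle, octahedron, chart; simpl.
  assert (Hc := circumradius_pos); assert (H3 := sqrt3_sqr).
  rewrite !Rabs_mult, (Rabs_right circumradius) by lra.
  split.
  - intros H.
    assert (E : Rabs ((1 + 2 * x) / 3) + Rabs ((1 - x + sqrt 3 * y) / 3)
                + Rabs ((1 - x - sqrt 3 * y) / 3) = 1)
      by (apply Rmult_eq_reg_l with circumradius; lra).
    exists ((1 + 2 * x) / 3), ((1 - x + sqrt 3 * y) / 3),
      ((1 - x - sqrt 3 * y) / 3).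
    repeat split;
      try (revert E; unfold Rabs; repeat destruct Rcase_abs; lra).
    f_equal; [lra |].
    transitivity ((sqrt 3 * sqrt 3) * y / 3); [rewrite H3; lra | field].
  - intros (a & b & c & Ha & Hb & Hc' & Hs & E).
    injection E; intros -> ->.
    replace ((1 + 2 * (a * 1 + b * (-1 / 2) + c * (-1 / 2))) / 3)
      with a by lra.
    replace (sqrt 3 * (a * 0 + b * (sqrt 3 / 2) + c * - (sqrt 3 / 2)))
      with ((sqrt 3 * sqrt 3) * (b - c) / 2) by field.
    rewrite H3.
    replace ((1 - (a * 1 + b * (-1 / 2) + c * (-1 / 2))
              + 3 * (b - c) / 2) / 3) with b by lra.
    replace ((1 - (a * 1 + b * (-1 / 2) + c * (-1 / 2))
              - 3 * (b - c) / 2) / 3) with c by lra.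
    rewrite !Rabs_right by lra.
    rewrite <- !Rmult_plus_distr_l, Hs; ring.
Qed.

Lemma is_J_root_unique : exists! x, is_J_root x.
Proof.
  destruct (IVT_gen (fun x => x ^ 3 - x ^ 2 - 4 * x + 1) 0 1 0)
    as [x [Hx E]].
  - intros x; reg.
  - unfold Rmin, Rmax; repeat destruct Rle_dec; lra.
  - rewrite Rmin_left, Rmax_right in Hx by lra.
    exists x; split.
    + split; [|exact E].
      split; apply Rnot_le_lt; intros H;
        [replace x with 0 in E by lra | replace x with 1 in E by lra]; lra.
    + intros z [Hz Ez].
      assert (H : (x - z) * (x ^ 2 + x * z + z ^ 2 - x - z - 4) = 0) by lra.
      apply Rmult_integral in H; destruct H as [H | H]; [lra | nra].
Qed.

Lemma J_root_spec : is_J_root J_root.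
Proof.
  unfold J_root; apply epsilon_spec.
  destruct is_J_root_unique as [x [Hx _]]; exists x; exact Hx.
Qed.

Lemma F_oct_spec (p : E3) : has_unique_farthest p -> farthest p (F_oct p).
Proof.
  intros [q [Hq _]]; unfold F_oct; apply epsilon_spec; exists q; exact Hq.
Qed.

(* Main.v *)
Require Import Defs.
From Stdlib Require Import Reals Lra Lia Psatz.
From Coquelicot Require Import Coquelicot.
Open Scope R_scope.

(* In barycentric coordinates, let [p] be a point of the first face and [- w]
   the antipode of a point [w] of this face. A path from [p] to [- w] can be
   replaced by a no longer one that crosses the coordinate planes once each, in
   one of six orders; rolling the octahedron into the plane along each order
   gives six images of [- w], and the distance is the least of the distances of
   [p] to these images. As functions of [w], they are the distances to six
   points of the plane. For [p] in [T], two vertices of the Voronoi diagram of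
   these six points, at the height of [p], are candidates for the farthest
   point: the common points of the cells of the orders 321, 312, 213 and of the
   orders 123, 213, 312. The first face is covered by triangles on each of
   which one of the six distances is at most the larger of the two candidate
   values; being convex, it has to be checked at the vertices only. The
   difference of the two values has the sign of the polynomial that defines
   [J]. *)

(** Distances are not computed in general. Each order bounds them above at every point of the
    opposite face, because a segment from the first face to the image crosses the rolled edges one
    after the other. A bound from below is needed at the two candidates only, but against arbitrary
    continuous paths: such a path is cut into chords of faces, along which an invariant travels,
    namely that some order compatible with a face of the current point [x] puts the image of [x]
    within the travelled length of [p]. Uniqueness comes from strict convexity: on a triangle of the
    cover the bound can reach the maximum at a vertex only, and the vertices other than the
    candidates stay strictly below it unless they collapse onto a candidate. Points outside the
    opposite face lose because a face has diameter [sqrt 3], less than the candidate distance. The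
    difference of the two values is [J_poly] times a nonnegative multiple of [c * (a - b)]; where
    this factor vanishes both candidates coincide with the antipode of [p], so that a tie off [J]
    does not produce two farthest points. *)

Inductive axis := ax1 | ax2 | ax3.

Definition coord (m : axis) (p : E3) : R :=
  let '(x, y, z) := p in
  match m with ax1 => x | ax2 => y | ax3 => z end.

Definition distinct (i j k : axis) : Prop := i <> j /\ j <> k /\ i <> k.

Lemma coord_ext (p q : E3) (i j k : axis) : distinct i j k ->
  coord i p = coord i q -> coord j p = coord j q -> coord k p = coord k q ->
  p = q.
Proof.
  destruct p as [[p1 p2] p3], q as [[q1 q2] q3].
  intros (H1 & H2 & H3); destruct i, j, k; simpl; intros; subst; congruence.
Qed.

Lemma dist3_coord (i j k : axis) (p q : E3) : distinct i j k ->
  dist3 p q = sqrt ((coord i q - coord i p) ^ 2 + (coord j q - coord j p) ^ 2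
                    + (coord k q - coord k p) ^ 2).
Proof.
  destruct p as [[p1 p2] p3], q as [[q1 q2] q3].
  intros (H1 & H2 & H3); unfold dist3;
    destruct i, j, k; try congruence; simpl; f_equal; ring.
Qed.

Lemma octahedron_coord (i j k : axis) (p : E3) : distinct i j k ->
  octahedron p <->
  Rabs (coord i p) + Rabs (coord j p) + Rabs (coord k p) = circumradius.
Proof.
  destruct p as [[p1 p2] p3].
  intros (H1 & H2 & H3); unfold octahedron;
    destruct i, j, k; try congruence; simpl; split; lra.
Qed.

Lemma dist3_nonneg (p q : E3) : 0 <= dist3 p q.
Proof.
  destruct p as [[p1 p2] p3], q as [[q1 q2] q3]; apply sqrt_pos.
Qed.

Lemma dist3_sym (p q : E3) : dist3 p q = dist3 q p.
Proof.
  destruct p as [[p1 p2] p3], q as [[q1 q2] q3]; unfold dist3; f_equal; ring.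
Qed.

Lemma minkowski (x1 x2 x3 y1 y2 y3 : R) :
  sqrt ((x1 + y1) ^ 2 + (x2 + y2) ^ 2 + (x3 + y3) ^ 2) <=
  sqrt (x1 ^ 2 + x2 ^ 2 + x3 ^ 2) + sqrt (y1 ^ 2 + y2 ^ 2 + y3 ^ 2).
Proof.
  set (X := x1 ^ 2 + x2 ^ 2 + x3 ^ 2); set (Y := y1 ^ 2 + y2 ^ 2 + y3 ^ 2).
  assert (HX : 0 <= X) by (unfold X; nra).
  assert (HY : 0 <= Y) by (unfold Y; nra).
  (* Cauchy-Schwarz by Lagrange's identity, whose three squares are supplied below. *)
  assert (CS : x1 * y1 + x2 * y2 + x3 * y3 <= sqrt X * sqrt Y).
  { rewrite <- sqrt_mult by assumption.
    apply Rle_trans with (Rabs (x1 * y1 + x2 * y2 + x3 * y3));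
      [apply Rle_abs |].
    rewrite <- sqrt_Rsqr_abs; apply sqrt_le_1_alt; unfold Rsqr, X, Y.
    pose proof (pow2_ge_0 (x1 * y2 - x2 * y1)).
    pose proof (pow2_ge_0 (x1 * y3 - x3 * y1)).
    pose proof (pow2_ge_0 (x2 * y3 - x3 * y2)).
    lra. }
  pose proof (sqrt_pos X); pose proof (sqrt_pos Y).
  pose proof (sqrt_sqrt X HX); pose proof (sqrt_sqrt Y HY).
  rewrite <- (sqrt_Rsqr (sqrt X + sqrt Y)) by lra.
  apply sqrt_le_1_alt; unfold Rsqr; unfold X, Y in *; nra.
Qed.

Lemma dist3_triangle (p q r : E3) : dist3 p r <= dist3 p q + dist3 q r.
Proof.
  destruct p as [[p1 p2] p3], q as [[q1 q2] q3], r as [[r1 r2] r3].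
  unfold dist3.
  replace (r1 - p1) with ((q1 - p1) + (r1 - q1)) by ring.
  replace (r2 - p2) with ((q2 - p2) + (r2 - q2)) by ring.
  replace (r3 - p3) with ((q3 - p3) + (r3 - q3)) by ring.
  apply minkowski.
Qed.

Lemma coord_ball (m : axis) (p q : E3) (e : R) :
  ball p e q -> Rabs (coord m q - coord m p) < e.
Proof.
  destruct p as [[p1 p2] p3], q as [[q1 q2] q3].
  intros [[H1 H2] H3]; destruct m; assumption.
Qed.

Lemma ball_dist3 (p q : E3) (e : R) : dist3 p q < e -> ball p e q.
Proof.
  destruct p as [[p1 p2] p3], q as [[q1 q2] q3]; unfold dist3; intros H.
  assert (A : forall u v, 0 <= v -> sqrt (u ^ 2 + v) < e -> Rabs u < e).
  { intros u v Hv Hu; apply Rle_lt_trans with (2 := Hu).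
    rewrite <- sqrt_Rsqr_abs; apply sqrt_le_1_alt; unfold Rsqr; nra. }
  assert (sum_sq : forall x y, 0 <= x ^ 2 + y ^ 2)
    by (intros; apply Rplus_le_le_0_compat; apply pow2_ge_0).
  split; [split |]; simpl.
  - apply (A (q1 - p1) ((q2 - p2) ^ 2 + (q3 - p3) ^ 2)); [apply sum_sq |].
    rewrite <- Rplus_assoc; exact H.
  - apply (A (q2 - p2) ((q1 - p1) ^ 2 + (q3 - p3) ^ 2)); [apply sum_sq |].
    replace ((q2 - p2) ^ 2 + ((q1 - p1) ^ 2 + (q3 - p3) ^ 2)) with
      ((q1 - p1) ^ 2 + (q2 - p2) ^ 2 + (q3 - p3) ^ 2) by ring; exact H.
  - apply (A (q3 - p3) ((q1 - p1) ^ 2 + (q2 - p2) ^ 2)); [apply sum_sq |].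
    rewrite Rplus_comm; exact H.
Qed.

(** * Paths and chains of points in common faces *)

(* On the octahedron this says that [p] and [q] lie in a common closed face. *)
Definition same_face (p q : E3) : Prop :=
  forall m, 0 <= coord m p * coord m q.

Lemma same_face_sym (p q : E3) : same_face p q -> same_face q p.
Proof. intros H m; rewrite Rmult_comm; apply H. Qed.

(** A nonzero coordinate keeps its sign under changes smaller than its absolute value; a zero
    coordinate satisfies the condition with every point. *)
Lemma same_face_near (g : R -> E3) (t : R) :
  continuous_on unit_interval g -> unit_interval t ->
  exists d, 0 < d /\ forall s, unit_interval s -> Rabs (s - t) < d ->
    same_face (g t) (g s).
Proof.
  intros Hg Ht.
  assert (A : forall m, exists d, 0 < d /\ forall s, unit_interval s ->
            Rabs (s - t) < d -> 0 <= coord m (g t) * coord m (g s)).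
  { intros m; destruct (Req_dec (coord m (g t)) 0) as [E | E].
    - exists 1; split; [lra | intros; rewrite E; lra].
    - assert (P : 0 < Rabs (coord m (g t))) by (apply Rabs_pos_lt; exact E).
      destruct (Hg t Ht (ball (g t) (Rabs (coord m (g t))))) as [d Hd].
      { exists (mkposreal _ P); intros; assumption. }
      exists d; split; [apply cond_pos |]; intros s Hs Hst.
      specialize (Hd s Hst Hs); apply (coord_ball m) in Hd.
      revert Hd; unfold Rabs; repeat destruct Rcase_abs; nra. }
  destruct (A ax1) as (d1 & P1 & H1), (A ax2) as (d2 & P2 & H2),
    (A ax3) as (d3 & P3 & H3).
  exists (Rmin d1 (Rmin d2 d3)); split.
  - repeat apply Rmin_pos; assumption.
  - intros s Hs Hst; intros [| |]; [apply H1 | apply H2 | apply H3];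
      try assumption; eapply Rlt_le_trans; try exact Hst;
      unfold Rmin; repeat destruct Rle_dec; lra.
Qed.

Definition face_subdivision (g : R -> E3) (n : nat) (t : nat -> R) : Prop :=
  t 0%nat = 0 /\
  (forall i, (i <= n)%nat ->
     t i <= t (S i) /\ same_face (g (t i)) (g (t (S i)))).

Lemma face_subdivision_extend (g : R -> E3) n t s :
  face_subdivision g n t -> t (S n) <= s -> same_face (g (t (S n))) (g s) ->
  exists t', face_subdivision g (S n) t' /\ t' (S (S n)) = s.
Proof.
  intros [H0 H1] Hs Hf.
  exists (fun i => if Nat.leb i (S n) then t i else s); split; [split |].
  - exact H0.
  - intros i Hi; cbv beta.
    destruct (Nat.leb_spec i (S n)); [| lia].
    destruct (Nat.leb_spec (S i) (S n)).
    + apply H1; lia.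
    + assert (i = S n) by lia; subst i; split; assumption.
  - destruct (Nat.leb_spec (S (S n)) (S n)); [lia | reflexivity].
Qed.

(* The supremum of the parameters that can be reached by subdivisions of the
   required kind is reached and cannot be less than 1. *)
Lemma face_subdivision_exists (g : R -> E3) :
  continuous_on unit_interval g ->
  exists n t, face_subdivision g n t /\ t (S n) = 1.
Proof.
  intros Hg.
  set (P := fun s => unit_interval s /\
              exists n t, face_subdivision g n t /\ t (S n) = s).
  assert (P0 : P 0).
  { split; [unfold unit_interval; lra |].
    exists 0%nat, (fun _ => 0); repeat split; try lra.
    intros m; apply Rle_0_sqr. }
  destruct (completeness P) as [m [Hub Hlub]].
  - exists 1; intros s [[_ Hs] _]; exact Hs.
  - exists 0; exact P0.
  - assert (Hm : unit_interval m).
    { split; [apply Hub, P0 |].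
      apply Hlub; intros s [[_ Hs] _]; exact Hs. }
    destruct (same_face_near g m Hg Hm) as (d & Hd & Hnear).
    assert (Pm : P m).
    { destruct (Classical_Prop.classic (exists s, P s /\ m - d < s))
        as [(s & [Hs (n & t & Ht & Es)] & Hsm) | H].
      - assert (s <= m) by (apply Hub; split; [| exists n, t]; auto).
        split; [exact Hm |].
        destruct (face_subdivision_extend g n t m) as (t' & Ht' & E); auto.
        + lra.
        + rewrite Es; apply same_face_sym, Hnear; auto.
          rewrite Rabs_left1; lra.
        + exists (S n), t'; auto.
      - assert (m <= m - d); [| lra].
        apply Hlub; intros s Hs; apply Rnot_lt_le; intros Hl.
        apply H; exists s; auto. }
    destruct (Rle_lt_dec 1 m) as [H1 | H1].
    + destruct Pm as [_ (n & t & Ht & E)]; exists n, t; split; auto.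
      destruct Hm; lra.
    + exfalso.
      set (s := Rmin 1 (m + d / 2)).
      assert (Hs : m < s <= 1 /\ s <= m + d / 2)
        by (unfold s, Rmin; destruct Rle_dec; lra).
      destruct Hm as [Hm0 Hm1].
      assert (Us : unit_interval s) by (split; lra).
      assert (P s); [| assert (s <= m) by (apply Hub; assumption); lra].
      split; [exact Us |].
      destruct Pm as [_ (n & t & Ht & E)].
      destruct (face_subdivision_extend g n t s) as (t' & Ht' & E'); auto.
      * lra.
      * rewrite E; apply Hnear; auto; rewrite Rabs_right; lra.
      * exists (S n), t'; auto.
Qed.

(* To bound distances from below, propagate along short steps a lower bound of
   the length travelled so far. *)
Lemma path_length_ge (I : E3 -> R -> Prop) (p q : E3) (m : R) :
  (forall x y l, octahedron x -> octahedron y -> same_face x y ->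
     I x l -> I y (l + dist3 x y)) ->
  I p 0 -> (forall l, I q l -> m <= l) ->
  Rbar_le m (dX p q).
Proof.
  intros Hstep Hp Hq.
  unfold dX; apply Glb_Rbar_correct.
  intros l (g & (Hc & Ho & E0 & E1) & Hl); simpl.
  destruct (face_subdivision_exists g Hc) as (n & t & [Ht0 Ht] & Ht1).
  assert (Hmono : forall i, (i <= S n)%nat -> 0 <= t i).
  { induction i; intros Hi; [lra |].
    apply Rle_trans with (t i); [apply IHi; lia | apply Ht; lia]. }
  assert (Hmono' : forall i, (i <= S n)%nat -> t (S n - i)%nat <= 1).
  { induction i; intros Hi.
    - rewrite Nat.sub_0_r, Ht1; lra.
    - apply Rle_trans with (t (S n - i)%nat); [| apply IHi; lia].
      replace (S n - i)%nat with (S (S n - S i)) by lia; apply Ht; lia. }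
  assert (Hu : forall i, (i <= S n)%nat -> octahedron (g (t i))).
  { intros i Hi; apply Ho; split; [apply Hmono; exact Hi |].
    replace i with (S n - (S n - i))%nat by lia; apply Hmono'; lia. }
  set (f := fun i => dist3 (g (t i)) (g (t (S i)))).
  assert (HI : forall i, (i <= n)%nat -> I (g (t (S i))) (sum_f_R0 f i)).
  { induction i; intros Hi.
    - simpl; replace (f 0%nat) with (0 + f 0%nat) by ring.
      apply Hstep; try (apply Hu; lia); [apply Ht; lia |].
      rewrite Ht0, E0; exact Hp.
    - simpl; apply Hstep; try (apply Hu; lia);
        [apply Ht; lia | apply IHi; lia]. }
  apply Rle_trans with (sum_f_R0 f n).
  - apply Hq; rewrite <- E1, <- Ht1; apply HI; lia.
  - assert (B : Rbar_le (sum_f_R0 f n) (path_length g)).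
    { unfold path_length; apply Lub_Rbar_correct.
      exists n, t; repeat split; auto; intros i Hi; apply Ht; exact Hi. }
    rewrite Hl in B; exact B.
Qed.

(** * Upper bounds *)

(** A 1-Lipschitz parametrization by an interval of length [l]: such curves concatenate without
    rescaling, and the Lipschitz bound gives both continuity and the bound on the length. *)
Definition reach (l : R) (p q : E3) : Prop :=
  0 <= l /\
  exists g : R -> E3,
    g 0 = p /\ g l = q /\
    (forall t, 0 <= t <= l -> octahedron (g t)) /\
    (forall s t, 0 <= s <= t -> t <= l -> dist3 (g s) (g t) <= t - s).

Lemma reach_dX (l : R) (p q : E3) : reach l p q -> Rbar_le (dX p q) l.
Proof.
  intros [Hl (g & E0 & E1 & Ho & HL)].
  set (h := fun t => g (l * t)).
  assert (HLh : forall s t, 0 <= s <= t -> t <= 1 ->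
                dist3 (h s) (h t) <= l * (t - s)).
  { intros s t H1 H2; unfold h.
    replace (l * (t - s)) with (l * t - l * s) by ring; apply HL; nra. }
  assert (HLh' : forall s t, unit_interval s -> unit_interval t ->
                dist3 (h s) (h t) <= l * Rabs (t - s)).
  { intros s t [H1 H2] [H3 H4]; destruct (Rle_dec s t).
    - rewrite Rabs_right by lra; apply HLh; lra.
    - rewrite dist3_sym, Rabs_minus_sym, Rabs_right by lra; apply HLh; lra. }
  assert (Hpath : path_on_octahedron p q h).
  { split; [| split; [| split]].
    - intros t Ht P [e He].
      (* [l + 1] keeps the divisor positive when [l = 0]. *)
      assert (Pd : 0 < e / (l + 1))
        by (apply Rdiv_lt_0_compat; [apply cond_pos | lra]).
      exists (mkposreal _ Pd); intros s Hs Us; apply He, ball_dist3.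
      apply Rle_lt_trans with (1 := HLh' t s Ht Us).
      change (Rabs (s - t) < e / (l + 1)) in Hs.
      apply Rle_lt_trans with ((l + 1) * Rabs (s - t)).
      + assert (0 <= Rabs (s - t)) by apply Rabs_pos; nra.
      + apply (Rmult_lt_compat_l (l + 1)) in Hs; [| lra].
        replace ((l + 1) * (e / (l + 1))) with (pos e) in Hs by (field; lra).
        exact Hs.
    - intros t [H1 H2]; apply Ho; nra.
    - unfold h; rewrite Rmult_0_r; exact E0.
    - unfold h; rewrite Rmult_1_r; exact E1. }
  assert (Hub : Rbar_le (path_length h) l).
  { apply Lub_Rbar_correct; intros x (n & t & T0 & T1 & Tm & ->); simpl.
    assert (Tle : forall i j, (i <= j <= S n)%nat -> t i <= t j).
    { intros i j [H1 H2]; induction H1 as [| j H1 IH]; [lra |].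
      apply Rle_trans with (t j); [apply IH; lia | apply Tm; lia]. }
    assert (forall k, (k <= n)%nat ->
      sum_f_R0 (fun i => dist3 (h (t i)) (h (t (S i)))) k <= l * t (S k)).
    { induction k; intros Hk; simpl.
      - replace (l * t 1%nat) with (l * (t 1%nat - t 0%nat)) by (rewrite T0; ring).
        apply HLh; [split; [lra | apply Tm; lia] |].
        rewrite <- T1; apply Tle; lia.
      - replace (l * t (S (S k))) with
          (l * t (S k) + l * (t (S (S k)) - t (S k))) by ring.
        apply Rplus_le_compat; [apply IHk; lia |].
        apply HLh; [split; [rewrite <- T0; apply Tle; lia | apply Tm; lia] |].
        rewrite <- T1; apply Tle; lia. }
    replace l with (l * t (S n)) by (rewrite T1; ring); apply H; lia. }
  (* The single chord, with [INR] as the subdivision 0, 1, excludes the value [m_infty]: [dX] only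
     ranges over paths whose length is a real number. *)
  assert (Hlb : Rbar_le (dist3 (h 0) (h 1)) (path_length h)).
  { apply Lub_Rbar_correct; exists 0%nat, INR; repeat split.
    intros i Hi; apply le_INR; lia. }
  destruct (path_length h) as [x | |] eqn:E; simpl in Hub, Hlb;
    try contradiction.
  apply Rbar_le_trans with x; [| exact Hub].
  unfold dX; apply Glb_Rbar_correct; exists h; split; assumption.
Qed.

Lemma reach_trans (l l' : R) (p q r : E3) :
  reach l p q -> reach l' q r -> reach (l + l') p r.
Proof.
  intros [Hl (g & G0 & G1 & Go & GL)] [Hl' (h & H0 & H1 & Ho & HL)].
  split; [lra |].
  exists (fun t => if Rle_dec t l then g t else h (t - l)).
  split; [| split; [| split]].
  - destruct Rle_dec; [exact G0 | lra].
  - destruct Rle_dec.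
    (* The first piece owns the junction, which is also the final parameter exactly when the second
       piece has length 0. *)
    + assert (l' = 0) by lra; subst l'.
      rewrite Rplus_0_r, G1, <- H1; congruence.
    + rewrite <- H1; f_equal; ring.
  - intros t Ht; destruct Rle_dec; [apply Go | apply Ho]; lra.
  - intros s t Hs Ht; destruct (Rle_dec s l), (Rle_dec t l).
    + apply GL; lra.
    + apply Rle_trans with (1 := dist3_triangle _ (g l) _).
      assert (A : dist3 (g s) (g l) <= l - s) by (apply GL; lra).
      assert (B : dist3 (h 0) (h (t - l)) <= t - l - 0) by (apply HL; lra).
      rewrite G1, <- H0 in *; lra.
    + lra.
    + replace (t - s) with (t - l - (s - l)) by ring; apply HL; lra.
Qed.

Lemma distinct_perms (i j k : axis) : distinct i j k ->
  distinct j i k /\ distinct i k j /\ distinct k i j /\ distinct j k i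
  /\ distinct k j i.
Proof. intros (H1 & H2 & H3); unfold distinct; intuition. Qed.

Definition lerp (p q : E3) (t : R) : E3 :=
  let '(p1, p2, p3) := p in
  let '(q1, q2, q3) := q in
  (p1 + t * (q1 - p1), p2 + t * (q2 - p2), p3 + t * (q3 - p3)).

Lemma coord_lerp (m : axis) (p q : E3) (t : R) :
  coord m (lerp p q t) = coord m p + t * (coord m q - coord m p).
Proof.
  destruct p as [[p1 p2] p3], q as [[q1 q2] q3], m; reflexivity.
Qed.

Lemma dist3_lerp (p q : E3) (s t : R) : s <= t ->
  dist3 (lerp p q s) (lerp p q t) = (t - s) * dist3 p q.
Proof.
  intros Hst; destruct p as [[p1 p2] p3], q as [[q1 q2] q3].
  unfold dist3; simpl lerp; cbv iota beta.
  rewrite <- (sqrt_Rsqr (t - s)) by lra.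
  rewrite <- sqrt_mult_alt by apply Rle_0_sqr.
  f_equal; unfold Rsqr; ring.
Qed.

Lemma lerp_0 (p q : E3) : lerp p q 0 = p.
Proof.
  destruct p as [[p1 p2] p3], q as [[q1 q2] q3]; simpl.
  f_equal; [f_equal |]; ring.
Qed.

Lemma lerp_1 (p q : E3) : lerp p q 1 = q.
Proof.
  destruct p as [[p1 p2] p3], q as [[q1 q2] q3]; simpl.
  f_equal; [f_equal |]; ring.
Qed.

Lemma dist3_eq_0 (p q : E3) : dist3 p q = 0 -> p = q.
Proof.
  destruct p as [[p1 p2] p3], q as [[q1 q2] q3]; unfold dist3; intros H.
  pose proof (pow2_ge_0 (q1 - p1)); pose proof (pow2_ge_0 (q2 - p2));
    pose proof (pow2_ge_0 (q3 - p3)).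
  apply sqrt_eq_0 in H; [| lra].
  f_equal; [f_equal |]; apply Rminus_diag_uniq_sym, Rsqr_0_uniq; unfold Rsqr; lra.
Qed.

(** Along a segment on which a coordinate does not change sign, its absolute value is affine. *)
Lemma octahedron_lerp (p q : E3) (t : R) :
  octahedron p -> octahedron q -> same_face p q -> 0 <= t <= 1 ->
  octahedron (lerp p q t).
Proof.
  intros Hp Hq Hs Ht.
  assert (A : forall m, Rabs (coord m (lerp p q t)) =
    (1 - t) * Rabs (coord m p) + t * Rabs (coord m q)).
  { intros m; rewrite coord_lerp; specialize (Hs m).
    revert Hs; generalize (coord m p), (coord m q); intros x y Hs.
    unfold Rabs; repeat destruct Rcase_abs; try nra. }
  assert (D : distinct ax1 ax2 ax3) by (repeat split; discriminate).
  apply (octahedron_coord _ _ _ _ D) in Hp, Hq.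
  apply (octahedron_coord _ _ _ _ D); rewrite !A.
  transitivity ((1 - t) * circumradius + t * circumradius); [| ring].
  rewrite <- Hp at 1; rewrite <- Hq; ring.
Qed.

Lemma reach_same_face (p q : E3) :
  octahedron p -> octahedron q -> same_face p q -> reach (dist3 p q) p q.
Proof.
  intros Hp Hq Hs; pose proof (dist3_nonneg p q) as Hd.
  split; [exact Hd |].
  destruct Hd as [Hd | Hd].
  - exists (fun t => lerp p q (t / dist3 p q)); split; [| split; [| split]].
    + unfold Rdiv; rewrite Rmult_0_l; apply lerp_0.
    + rewrite Rdiv_diag by lra; apply lerp_1.
    + intros t Ht; apply octahedron_lerp; auto.
      split; [apply Rdiv_le_0_compat | apply Rle_div_l]; lra.
    + intros s t H1 H2; rewrite dist3_lerp.
      * right; field; lra.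
      * apply Rmult_le_compat_r; [left; apply Rinv_0_lt_compat |]; lra.
  - assert (p = q) by (apply dist3_eq_0; auto); subst q.
    exists (fun _ => p); repeat split; auto.
    intros s t H1 H2; rewrite <- Hd; lra.
Qed.

(** * Unfoldings *)

Definition axis_eq_dec (m n : axis) : {m = n} + {m <> n}.
Proof. decide equality. Defined.

Definition place (i j k : axis) (u v w : R) : E3 :=
  let f m := if axis_eq_dec m i then u else if axis_eq_dec m j then v else w in
  (f ax1, f ax2, f ax3).

Lemma coord_place (i j k : axis) (u v w : R) : distinct i j k ->
  coord i (place i j k u v w) = u /\ coord j (place i j k u v w) = v /\
  coord k (place i j k u v w) = w.
Proof.
  intros (H1 & H2 & H3); destruct i, j, k; try congruence; repeat split.
Qed.

(** The correction made by rolling across an edge is active only beyond that edge; negative parts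
    let one formula serve all faces of a strip. *)
Definition negpart (x : R) : R := Rmin x 0.

Lemma negpart_nonneg (x : R) : 0 <= x -> negpart x = 0.
Proof. intros H; apply Rmin_right; exact H. Qed.

Lemma negpart_nonpos (x : R) : x <= 0 -> negpart x = x.
Proof. intros H; apply Rmin_left; exact H. Qed.

(* Rolls the faces with outward normals [+++], [-++], [--+], [---] (signs of
   the coordinates [i], [j], [k]) into the plane of the first of these faces,
   across their consecutive common edges. *)
Definition unfolding (i j k : axis) (x : E3) : E3 :=
  let '(u, v, w) := (coord i x, coord j x, coord k x) in
  place i j k (u + negpart v + 2 * negpart w)
              (v - negpart u - negpart v - negpart w)
              (w - negpart u - 2 * negpart v - 3 * negpart w).

Definition face (f : axis -> bool) (x : E3) : Prop :=
  forall m, if f m then 0 <= coord m x else coord m x <= 0.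

(** The face [f] belongs to the strip unfolded by [unfolding i j k]: along it the signs turn
    negative in the order [i], [j], [k]. *)
Definition rolls (f : axis -> bool) (i j k : axis) : Prop :=
  (f i = true -> f j = true) /\ (f j = true -> f k = true).

Lemma same_face_iff (x y : E3) :
  same_face x y <-> exists f, face f x /\ face f y.
Proof.
  split.
  - intros H.
    exists (fun m => if Rle_dec 0 (coord m x) then
                       if Rle_dec 0 (coord m y) then true
                       else if Rle_dec (coord m x) 0 then false else true
                     else false).
    split; intros m; specialize (H m);
      destruct (Rle_dec 0 (coord m x)), (Rle_dec 0 (coord m y)),
        (Rle_dec (coord m x) 0); try lra; nra.
  - intros (f & Hx & Hy) m; specialize (Hx m); specialize (Hy m).
    destruct (f m); nra.
Qed.

Lemma face_sum (f : axis -> bool) (i j k : axis) (x : E3) :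
  distinct i j k -> face f x -> octahedron x ->
  (if f i then coord i x else - coord i x) +
  (if f j then coord j x else - coord j x) +
  (if f k then coord k x else - coord k x) = circumradius.
Proof.
  intros D Hf Ho; apply (octahedron_coord _ _ _ _ D) in Ho; rewrite <- Ho.
  f_equal; [f_equal |];
    match goal with |- (if f ?m then _ else _) = _ =>
      specialize (Hf m); destruct (f m); [rewrite Rabs_pos_eq | rewrite Rabs_left1]; lra end.
Qed.

Lemma rolls_cases (f : axis -> bool) (i j k : axis) : rolls f i j k ->
  (f i = true /\ f j = true /\ f k = true) \/
  (f i = false /\ f j = true /\ f k = true) \/
  (f i = false /\ f j = false /\ f k = true) \/
  (f i = false /\ f j = false /\ f k = false).
Proof. intros [H1 H2]; destruct (f i), (f j), (f k); intuition congruence. Qed.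

(** On one face of the strip the unfolding is affine. It is isometric on the plane of this face,
    whose equation serves to eliminate the third coordinate. *)
Lemma unfolding_isometry (f : axis -> bool) (i j k : axis) (x y : E3) :
  distinct i j k -> rolls f i j k -> face f x -> face f y ->
  octahedron x -> octahedron y ->
  dist3 (unfolding i j k x) (unfolding i j k y) = dist3 x y.
Proof.
  intros D Hr Hx Hy Ox Oy.
  pose proof (face_sum f i j k x D Hx Ox) as Sx.
  pose proof (face_sum f i j k y D Hy Oy) as Sy.
  rewrite !(dist3_coord i j k _ _ D); unfold unfolding.
  destruct (coord_place i j k
    (coord i x + negpart (coord j x) + 2 * negpart (coord k x))
    (coord j x - negpart (coord i x) - negpart (coord j x) - negpart (coord k x))
    (coord k x - negpart (coord i x) - 2 * negpart (coord j x) - 3 * negpart (coord k x)) D)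
    as (-> & -> & ->).
  destruct (coord_place i j k
    (coord i y + negpart (coord j y) + 2 * negpart (coord k y))
    (coord j y - negpart (coord i y) - negpart (coord j y) - negpart (coord k y))
    (coord k y - negpart (coord i y) - 2 * negpart (coord j y) - 3 * negpart (coord k y)) D)
    as (-> & -> & ->).
  f_equal.
  pose proof (Hx i) as X1; pose proof (Hx j) as X2; pose proof (Hx k) as X3.
  pose proof (Hy i) as Y1; pose proof (Hy j) as Y2; pose proof (Hy k) as Y3.
  destruct (rolls_cases f i j k Hr) as
    [(E1 & E2 & E3) | [(E1 & E2 & E3) | [(E1 & E2 & E3) | (E1 & E2 & E3)]]];
    rewrite E1, E2, E3 in *;
    rewrite ?(negpart_nonneg (coord i x)), ?(negpart_nonneg (coord j x)),
      ?(negpart_nonneg (coord k x)), ?(negpart_nonneg (coord i y)),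
      ?(negpart_nonneg (coord j y)), ?(negpart_nonneg (coord k y)),
      ?(negpart_nonpos (coord i x)), ?(negpart_nonpos (coord j x)),
      ?(negpart_nonpos (coord k x)), ?(negpart_nonpos (coord i y)),
      ?(negpart_nonpos (coord j y)), ?(negpart_nonpos (coord k y)) by assumption;
    generalize dependent (coord i x); generalize dependent (coord j x);
    generalize dependent (coord k x); generalize dependent (coord i y);
    generalize dependent (coord j y); generalize dependent (coord k y);
    intros yk Y3 yj Y2 yi Y1 Sy xk X3 xj X2 xi X1 Sx.
  - ring.
  - replace xk with (circumradius + xi - xj) by lra.
    replace yk with (circumradius + yi - yj) by lra; ring.
  - replace xk with (circumradius + xi + xj) by lra.
    replace yk with (circumradius + yi + yj) by lra; ring.
  - replace xk with (- circumradius - xi - xj) by lra.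
    replace yk with (- circumradius - yi - yj) by lra; ring.
Qed.

Lemma dist3_unfolding (i j k : axis) (p x : E3) : distinct i j k ->
  dist3 p (unfolding i j k x) =
  sqrt ((coord i x + negpart (coord j x) + 2 * negpart (coord k x) - coord i p) ^ 2 +
        (coord j x - negpart (coord i x) - negpart (coord j x) - negpart (coord k x)
         - coord j p) ^ 2 +
        (coord k x - negpart (coord i x) - 2 * negpart (coord j x)
         - 3 * negpart (coord k x) - coord k p) ^ 2).
Proof.
  intros D; rewrite (dist3_coord i j k _ _ D); unfold unfolding.
  destruct (coord_place i j k
    (coord i x + negpart (coord j x) + 2 * negpart (coord k x))
    (coord j x - negpart (coord i x) - negpart (coord j x) - negpart (coord k x))
    (coord k x - negpart (coord i x) - 2 * negpart (coord j x) - 3 * negpart (coord k x)) D)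
    as (-> & -> & ->); reflexivity.
Qed.

Definition octant (p : E3) : Prop :=
  octahedron p /\ forall m, 0 <= coord m p.

Lemma octant_sum (i j k : axis) (p : E3) : distinct i j k -> octant p ->
  coord i p + coord j p + coord k p = circumradius.
Proof.
  intros D [Ho Hp]; exact (face_sum (fun _ => true) i j k p D Hp Ho).
Qed.

Ltac simpl_negpart :=
  repeat match goal with
  | H : 0 <= ?x |- context [negpart ?x] => rewrite (negpart_nonneg x H)
  | H : ?x <= 0 |- context [negpart ?x] => rewrite (negpart_nonpos x H)
  end.

(* For paths that do not follow one of the six sequences of faces: the unfolding
   can be changed whenever the path meets an edge or a vertex. *)
Lemma unfolding_switch (f f' : axis -> bool) (i j k : axis) (p x : E3) :
  distinct i j k -> octant p -> octahedron x -> face f x -> face f' x ->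
  rolls f' i j k ->
  exists i' j' k', distinct i' j' k' /\ rolls f i' j' k' /\
    dist3 p (unfolding i' j' k' x) <= dist3 p (unfolding i j k x).
Proof.
  intros D Hp Hx Hf Hf' Hr.
  destruct (distinct_perms i j k D) as (D1 & D2 & D3 & D4 & D5).
  pose proof (octant_sum i j k p D Hp) as Sp; destruct Hp as [_ Hp].
  pose proof (face_sum f i j k x D Hf Hx) as Sx.
  assert (Hc := circumradius_pos).
  pose proof (Hp i) as Pi; pose proof (Hp j) as Pj; pose proof (Hp k) as Pk.
  pose proof (Hf i) as X1; pose proof (Hf j) as X2; pose proof (Hf k) as X3.
  pose proof (Hf' i) as Y1; pose proof (Hf' j) as Y2; pose proof (Hf' k) as Y3.
  destruct (f i) eqn:E1, (f j) eqn:E2, (f k) eqn:E3;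
  try (exists i, j, k; split; [exact D | split;
       [split; congruence | lra]]; fail);
  (* Four sign patterns of [f] are not in the strip. The new order lists the axes that are negative
     in [f] first and otherwise keeps the old order. Coordinates with different signs in [f] and
     [f'] vanish at [x]. *)
  [exists k, i, j | exists j, i, k | exists j, k, i | exists i, k, j];
  (split; [assumption | split; [split; congruence |]]);
  rewrite !dist3_unfolding by assumption; apply sqrt_le_1_alt;
  destruct (rolls_cases f' i j k Hr) as
    [(F1 & F2 & F3) | [(F1 & F2 & F3) | [(F1 & F2 & F3) | (F1 & F2 & F3)]]];
    rewrite F1, F2, F3 in *;
  simpl_negpart;
  generalize dependent (coord i x); generalize dependent (coord j x);
  generalize dependent (coord k x); generalize dependent (coord i p);
  generalize dependent (coord j p); generalize dependent (coord k p);
  intros c Pc b Pb a Pa Sp z X3 Y3 y X2 Y2 x' X1 Y1 Sx;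
  repeat match goal with
  | H1 : 0 <= ?t, H2 : ?t <= 0 |- _ =>
      assert (t = 0) by lra; subst t; clear H1 H2
  end; clear D D1 D2 D3 D4 D5 Hr Hf Hf' Hp Hx E1 E2 E3 F1 F2 F3.
  all: nra.
Qed.

(** Before each short step the order is switched to one compatible with the face that contains the
    step; on this face the unfolding is isometric, so the triangle inequality carries the invariant
    over. *)
Lemma dX_ge_unfolding (p q : E3) (m : R) :
  octant p -> octahedron q -> (forall a, coord a q <= 0) ->
  (forall i j k, distinct i j k -> m <= dist3 p (unfolding i j k q)) ->
  Rbar_le m (dX p q).
Proof.
  intros Hp Oq Hq Hm.
  apply (path_length_ge (fun x l => exists (f : axis -> bool) i j k, distinct i j k /\
           face f x /\ rolls f i j k /\ dist3 p (unfolding i j k x) <= l)).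
  - intros x y l Ox Oy Hs (f' & i & j & k & D & Hf' & Hr & Hl).
    apply same_face_iff in Hs; destruct Hs as (f & Hx & Hy).
    destruct (unfolding_switch f f' i j k p x) as (i' & j' & k' & D' & Hr' & H');
      auto.
    exists f, i', j', k'; repeat split; auto; try apply D'; try apply Hr'.
    apply Rle_trans with (1 := dist3_triangle _ (unfolding i' j' k' x) _).
    rewrite (unfolding_isometry f) by auto; lra.
  - assert (D : distinct ax1 ax2 ax3) by (repeat split; discriminate).
    exists (fun _ => true), ax1, ax2, ax3; repeat split; try apply D; auto.
    + intros a; apply Hp.
    + right; rewrite dist3_unfolding by exact D.
      destruct Hp as [_ Hp].
      rewrite !negpart_nonneg by apply Hp.
      transitivity (sqrt 0); [f_equal; ring | apply sqrt_0].
  - intros l (f & i & j & k & D & _ & _ & Hl).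
    apply Rle_trans with (2 := Hl); apply Hm; exact D.
Qed.

(* [x] is the point where the straight segment from [p] to the unfolding of [q]
   crosses the last edge. *)
Lemma reach_through (f : axis -> bool) (i j k : axis) (p q x : E3) (t : R) :
  distinct i j k -> rolls f i j k -> face f x -> face f q ->
  octahedron x -> octahedron q -> 0 <= t <= 1 ->
  unfolding i j k x = lerp p (unfolding i j k q) t ->
  reach (dist3 p (unfolding i j k x)) p x ->
  reach (dist3 p (unfolding i j k q)) p q.
Proof.
  intros D Hr Hx Hq Ox Oq Ht E H.
  replace (dist3 p (unfolding i j k q)) with
    (dist3 p (unfolding i j k x) + dist3 x q).
  - apply reach_trans with (1 := H).
    apply reach_same_face; auto; apply same_face_iff; exists f; auto.
  - rewrite <- (unfolding_isometry f i j k x q) by auto; rewrite E.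
    set (Q := unfolding i j k q).
    rewrite <- (lerp_0 p Q) at 1; rewrite <- (lerp_1 p Q) at 4.
    rewrite !dist3_lerp by lra; ring.
Qed.

Lemma coord_unfolding (i j k : axis) (x : E3) : distinct i j k ->
  coord i (unfolding i j k x) =
    coord i x + negpart (coord j x) + 2 * negpart (coord k x) /\
  coord j (unfolding i j k x) =
    coord j x - negpart (coord i x) - negpart (coord j x)
    - negpart (coord k x) /\
  coord k (unfolding i j k x) =
    coord k x - negpart (coord i x) - 2 * negpart (coord j x)
    - 3 * negpart (coord k x).
Proof. apply coord_place. Qed.

Lemma face_intro (f : axis -> bool) (i j k : axis) (x : E3) :
  distinct i j k ->
  (if f i then 0 <= coord i x else coord i x <= 0) ->
  (if f j then 0 <= coord j x else coord j x <= 0) ->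
  (if f k then 0 <= coord k x else coord k x <= 0) -> face f x.
Proof.
  intros (H1 & H2 & H3) A B C m; destruct i, j, k, m;
    first [congruence | assumption].
Qed.

Lemma octahedron_intro (i j k : axis) (x : E3) : distinct i j k ->
  forall si sj sk : bool,
  (if si then 0 <= coord i x else coord i x <= 0) ->
  (if sj then 0 <= coord j x else coord j x <= 0) ->
  (if sk then 0 <= coord k x else coord k x <= 0) ->
  (if si then coord i x else - coord i x) +
  (if sj then coord j x else - coord j x) +
  (if sk then coord k x else - coord k x) = circumradius -> octahedron x.
Proof.
  intros D si sj sk A B C E; apply (octahedron_coord _ _ _ _ D); rewrite <- E.
  f_equal; [f_equal |];
    match goal with |- _ = (if ?s then _ else _) =>
      destruct s; [rewrite Rabs_pos_eq | rewrite Rabs_left1]; lra end.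
Qed.

(** [u] and [v] are the distances of the ends of a segment from a line between them, and [t] is the
    parameter of the crossing. If the segment lies in the line, its end is taken. *)
Lemma ratio (u v : R) : 0 <= u -> 0 <= v ->
  exists t, 0 <= t <= 1 /\ t * (u + v) = u.
Proof.
  intros Hu Hv; destruct (Req_dec (u + v) 0) as [E | E].
  - exists 1; lra.
  - exists (u / (u + v)); split; [split | field; exact E].
    + apply Rdiv_le_0_compat; lra.
    + apply Rle_div_l; lra.
Qed.

(** * Upper bounds by straight segments in the unfolding *)

Section Reach.

Variables (i j k : axis) (p : E3).
Hypothesis (D : distinct i j k) (Hp : octant p).

Lemma unfolding_octant (q : E3) :
  (forall m, 0 <= coord m q) -> unfolding i j k q = q.
Proof.
  intros H; apply (coord_ext _ _ i j k D);
    destruct (coord_unfolding i j k q D) as (E1 & E2 & E3);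
    rewrite ?E1, ?E2, ?E3, !negpart_nonneg by apply H; ring.
Qed.

Lemma reach_unfolding0 (q : E3) :
  octant q -> reach (dist3 p (unfolding i j k q)) p q.
Proof.
  intros [Oq Hq]; rewrite unfolding_octant by exact Hq.
  apply reach_same_face; [apply Hp | exact Oq |].
  intros m; apply Rmult_le_pos; [apply Hp | apply Hq].
Qed.

Lemma reach_unfolding1 (q : E3) :
  octahedron q -> coord i q <= 0 -> 0 <= coord j q -> 0 <= coord k q ->
  reach (dist3 p (unfolding i j k q)) p q.
Proof.
  intros Oq Qi Qj Qk.
  set (f := fun m => if axis_eq_dec m i then false else true).
  destruct D as (Dij & Djk & Dik).
  assert (Fi : f i = false) by (unfold f; destruct axis_eq_dec; congruence).
  assert (Fj : f j = true) by (unfold f; destruct axis_eq_dec; congruence).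
  assert (Fk : f k = true) by (unfold f; destruct axis_eq_dec; congruence).
  assert (Hq : face f q)
    by (apply (face_intro f i j k q D); rewrite ?Fi, ?Fj, ?Fk; assumption).
  pose proof (face_sum f i j k q D Hq Oq) as Sq; rewrite Fi, Fj, Fk in Sq.
  pose proof (octant_sum i j k p D Hp) as Sp.
  pose proof (proj2 Hp i) as Pi; pose proof (proj2 Hp j) as Pj;
    pose proof (proj2 Hp k) as Pk.
  (* In the unfolding the first edge lies on the line where coordinate [i] is 0. *)
  destruct (ratio (coord i p) (- coord i q)) as (t & Ht & Et); try lra.
  set (u := coord j p + t * (coord j q - coord i q - coord j p)).
  set (v := coord k p + t * (coord k q - coord i q - coord k p)).
  assert (Hu : 0 <= u) by (unfold u; nra).
  assert (Hv : 0 <= v) by (unfold v; nra).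
  assert (Suv : u + v = circumradius) by (unfold u, v; nra).
  set (x := place i j k 0 u v).
  destruct (coord_place i j k 0 u v D) as (Xi & Xj & Xk); fold x in Xi, Xj, Xk.
  assert (Ox : octahedron x).
  { apply (octahedron_intro i j k x D true true true);
      rewrite ?Xi, ?Xj, ?Xk; lra. }
  assert (Px : forall m, 0 <= coord m x).
  { apply (face_intro (fun _ => true) i j k x D); rewrite ?Xi, ?Xj, ?Xk; lra. }
  apply (reach_through f i j k p q x t); auto.
  - split; congruence.
  - apply (face_intro f i j k x D); rewrite ?Fi, ?Fj, ?Fk, ?Xi, ?Xj, ?Xk; lra.
  - apply (coord_ext _ _ i j k D); rewrite coord_lerp;
      destruct (coord_unfolding i j k x D) as (E1 & E2 & E3);
      destruct (coord_unfolding i j k q D) as (G1 & G2 & G3);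
      rewrite ?E1, ?E2, ?E3, ?G1, ?G2, ?G3, ?Xi, ?Xj, ?Xk; simpl_negpart;
      rewrite ?(negpart_nonneg 0) by lra; unfold u, v; nra.
  - apply reach_unfolding0; split; assumption.
Qed.

Lemma reach_unfolding2 (q : E3) :
  octahedron q -> coord i q <= 0 -> coord j q <= 0 -> 0 <= coord k q ->
  reach (dist3 p (unfolding i j k q)) p q.
Proof.
  intros Oq Qi Qj Qk.
  set (f := fun m => if axis_eq_dec m k then true else false).
  destruct D as (Dij & Djk & Dik).
  assert (Fi : f i = false) by (unfold f; destruct axis_eq_dec; congruence).
  assert (Fj : f j = false) by (unfold f; destruct axis_eq_dec; congruence).
  assert (Fk : f k = true) by (unfold f; destruct axis_eq_dec; congruence).
  assert (Hq : face f q)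
    by (apply (face_intro f i j k q D); rewrite ?Fi, ?Fj, ?Fk; assumption).
  pose proof (face_sum f i j k q D Hq Oq) as Sq; rewrite Fi, Fj, Fk in Sq.
  pose proof (octant_sum i j k p D Hp) as Sp.
  pose proof (proj2 Hp i) as Pi; pose proof (proj2 Hp j) as Pj;
    pose proof (proj2 Hp k) as Pk.
  (* The second edge unfolds into the line where coordinate [k] is [circumradius]; the image of [q]
     lies beyond it by [- coord j q]. *)
  destruct (ratio (circumradius - coord k p) (- coord j q)) as (t & Ht & Et);
    try lra.
  set (u := coord i p + t * (coord i q + coord j q - coord i p)).
  assert (Eu : - u = coord j p + t * (- coord i q - coord j p))
    by (unfold u; nra).
  assert (Hu : 0 <= - u) by (rewrite Eu; nra).
  assert (Hu' : - u <= circumradius) by (rewrite Eu; nra).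
  set (x := place i j k u 0 (circumradius + u)).
  destruct (coord_place i j k u 0 (circumradius + u) D) as (Xi & Xj & Xk);
    fold x in Xi, Xj, Xk.
  assert (Ox : octahedron x).
  { apply (octahedron_intro i j k x D false true true);
      rewrite ?Xi, ?Xj, ?Xk; lra. }
  apply (reach_through f i j k p q x t); auto.
  - split; congruence.
  - apply (face_intro f i j k x D); rewrite ?Fi, ?Fj, ?Fk, ?Xi, ?Xj, ?Xk; lra.
  - assert (U1 : u <= 0) by lra; assert (U2 : 0 <= circumradius + u) by lra.
    apply (coord_ext _ _ i j k D); rewrite coord_lerp;
      destruct (coord_unfolding i j k x D) as (E1 & E2 & E3);
      destruct (coord_unfolding i j k q D) as (G1 & G2 & G3);
      rewrite ?E1, ?E2, ?E3, ?G1, ?G2, ?G3, ?Xi, ?Xj, ?Xk; simpl_negpart;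
      rewrite ?(negpart_nonneg 0) by lra.
    + unfold u; ring.
    + lra.
    + replace (coord k q) with (circumradius + coord i q + coord j q) by lra; lra.
  - apply reach_unfolding1; auto; rewrite ?Xi, ?Xj, ?Xk; lra.
Qed.

Lemma reach_unfolding3 (q : E3) :
  octahedron q -> coord i q <= 0 -> coord j q <= 0 -> coord k q <= 0 ->
  reach (dist3 p (unfolding i j k q)) p q.
Proof.
  intros Oq Qi Qj Qk.
  set (f := fun m : axis => false).
  assert (Hq : face f q)
    by (apply (face_intro f i j k q D); assumption).
  pose proof (face_sum f i j k q D Hq Oq) as Sq; unfold f in Sq.
  pose proof (octant_sum i j k p D Hp) as Sp.
  pose proof (proj2 Hp i) as Pi; pose proof (proj2 Hp j) as Pj;
    pose proof (proj2 Hp k) as Pk.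
  assert (Hc := circumradius_pos).
  (* The third edge unfolds into the line where coordinate [i] is [- circumradius]; the image of [q]
     lies beyond it by [- coord k q]. *)
  destruct (ratio (circumradius + coord i p) (- coord k q)) as (t & Ht & Et);
    try lra.
  set (u := - (coord j p + t * (- coord i q - coord k q - coord j p))).
  assert (Hu : 0 <= - u) by (unfold u; nra).
  assert (Hu' : - u <= circumradius) by (unfold u; nra).
  set (x := place i j k u (- circumradius - u) 0).
  destruct (coord_place i j k u (- circumradius - u) 0 D) as (Xi & Xj & Xk);
    fold x in Xi, Xj, Xk.
  assert (Ox : octahedron x).
  { apply (octahedron_intro i j k x D false false true);
      rewrite ?Xi, ?Xj, ?Xk; lra. }
  apply (reach_through f i j k p q x t); auto.
  - split; discriminate.
  - apply (face_intro f i j k x D); unfold f; rewrite ?Xi, ?Xj, ?Xk; lra.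
  - assert (U1 : u <= 0) by lra; assert (U2 : - circumradius - u <= 0) by lra.
    apply (coord_ext _ _ i j k D); rewrite coord_lerp;
      destruct (coord_unfolding i j k x D) as (E1 & E2 & E3);
      destruct (coord_unfolding i j k q D) as (G1 & G2 & G3);
      rewrite ?E1, ?E2, ?E3, ?G1, ?G2, ?G3, ?Xi, ?Xj, ?Xk; simpl_negpart;
      rewrite ?(negpart_nonneg 0) by lra.
    + replace (coord i q) with (- circumradius - coord j q - coord k q) by lra; lra.
    + unfold u; ring.
    + unfold u; replace (coord i q) with (- circumradius - coord j q - coord k q) by lra.
      replace (coord j p) with (circumradius - coord i p - coord k p) by lra; lra.
  - apply reach_unfolding2; auto; rewrite ?Xi, ?Xj, ?Xk; lra.
Qed.

End Reach.

Lemma dX_le_unfolding (f : axis -> bool) (i j k : axis) (p q : E3) :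
  distinct i j k -> octant p -> octahedron q -> face f q -> rolls f i j k ->
  Rbar_le (dX p q) (dist3 p (unfolding i j k q)).
Proof.
  intros D Hp Oq Hq Hr; apply reach_dX.
  pose proof (Hq i) as Q1; pose proof (Hq j) as Q2; pose proof (Hq k) as Q3.
  destruct (rolls_cases f i j k Hr) as
    [(E1 & E2 & E3) | [(E1 & E2 & E3) | [(E1 & E2 & E3) | (E1 & E2 & E3)]]];
    rewrite E1, E2, E3 in *.
  - apply reach_unfolding0; auto; split; [exact Oq |].
    apply (face_intro (fun _ => true) i j k q D); assumption.
  - apply reach_unfolding1; assumption.
  - apply reach_unfolding2; assumption.
  - apply reach_unfolding3; assumption.
Qed.

(** * Covering a triangle by discs *)

Definition combo (l m n : R) (A B C : E3) : E3 :=
  let '(a1, a2, a3) := A in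
  let '(b1, b2, b3) := B in
  let '(c1, c2, c3) := C in
  (l * a1 + m * b1 + n * c1, l * a2 + m * b2 + n * c2,
   l * a3 + m * b3 + n * c3).

Definition hull3 (A B C w : E3) : Prop :=
  exists l m n, 0 <= l /\ 0 <= m /\ 0 <= n /\ l + m + n = 1 /\
    w = combo l m n A B C.

(* [sqrt (3 / 2 * dist_sq i j k p q)] is the distance between the point with
   barycentric coordinates [p] of the first face and the unfolding along
   [i], [j], [k] of the antipode of the one with coordinates [q], see
   [dist3_unfolding_antipode]. *)
Definition dist_sq (i j k : axis) (p q : E3) : R :=
  (1 + coord i p + coord k q) ^ 2 + (1 - coord j p - coord j q) ^ 2
  + (2 - coord k p - coord i q) ^ 2.

Lemma coord_combo (m : axis) (l1 l2 l3 : R) (A B C : E3) :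
  coord m (combo l1 l2 l3 A B C) =
  l1 * coord m A + l2 * coord m B + l3 * coord m C.
Proof.
  destruct A as [[? ?] ?], B as [[? ?] ?], C as [[? ?] ?], m; reflexivity.
Qed.

Lemma axes_distinct : distinct ax1 ax2 ax3.
Proof. repeat split; discriminate. Qed.

(** A disc is strictly convex, so a triangle inscribed in it can meet the circle in its vertices
    only. The strictness is what later singles out the farthest points. *)
Lemma disc_triangle (i j k : axis) (p A B C w : E3) (M : R) :
  distinct i j k ->
  dist_sq i j k p A <= M -> dist_sq i j k p B <= M -> dist_sq i j k p C <= M ->
  hull3 A B C w -> dist_sq i j k p w < M \/ w = A \/ w = B \/ w = C.
Proof.
  intros D HA HB HC (l & m & n & Hl & Hm & Hn & Hs & Hw).
  set (N := fun U V : E3 => (coord i U - coord i V) ^ 2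
    + (coord j U - coord j V) ^ 2 + (coord k U - coord k V) ^ 2).
  assert (NP : forall U V, 0 <= N U V).
  { intros U V; unfold N.
    pose proof (pow2_ge_0 (coord i U - coord i V)).
    pose proof (pow2_ge_0 (coord j U - coord j V)).
    pose proof (pow2_ge_0 (coord k U - coord k V)); lra. }
  assert (N0 : forall r U V, r * N U V = 0 -> forall x,
     r * (coord x U - coord x V) = 0).
  { intros r U V H x; apply Rmult_integral in H; destruct H as [-> | H]; [ring |].
    replace (coord x U - coord x V) with 0; [ring |].
    unfold N in H.
    pose proof (pow2_ge_0 (coord i U - coord i V)).
    pose proof (pow2_ge_0 (coord j U - coord j V)).
    pose proof (pow2_ge_0 (coord k U - coord k V)).
    destruct D as (D1 & D2 & D3); symmetry; apply Rsqr_0_uniq.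
    unfold Rsqr; destruct i, j, k, x; try congruence; lra. }
  (* Leibniz's identity: the squared distance at a weighted mean is the mean of the squared
     distances minus the weighted squares of the sides. *)
  assert (E : dist_sq i j k p w =
    l * dist_sq i j k p A + m * dist_sq i j k p B + n * dist_sq i j k p C
    - (l * (m * N A B) + l * (n * N A C) + m * (n * N B C))).
  { subst w; unfold dist_sq, N; rewrite !coord_combo.
    replace l with (1 - m - n) by lra; ring. }
  destruct (Rlt_le_dec (dist_sq i j k p w) M) as [H | H]; [left; exact H | right].
  assert (PAB : 0 <= l * (m * N A B)) by (repeat apply Rmult_le_pos; auto).
  assert (PAC : 0 <= l * (n * N A C)) by (repeat apply Rmult_le_pos; auto).
  assert (PBC : 0 <= m * (n * N B C)) by (repeat apply Rmult_le_pos; auto).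
  assert (l * dist_sq i j k p A <= l * M) by (apply Rmult_le_compat_l; auto).
  assert (m * dist_sq i j k p B <= m * M) by (apply Rmult_le_compat_l; auto).
  assert (n * dist_sq i j k p C <= n * M) by (apply Rmult_le_compat_l; auto).
  assert (l * M + m * M + n * M = M)
    by (rewrite <- !Rmult_plus_distr_r, Hs; ring).
  assert (ZAB : l * (m * N A B) = 0) by lra.
  assert (ZAC : l * (n * N A C) = 0) by lra.
  assert (ZBC : m * (n * N B C) = 0) by lra.
  assert (Ext : forall U, (forall x, coord x w = coord x U) -> w = U)
    by (intros U HU; apply (coord_ext _ _ _ _ _ axes_distinct); apply HU).
  destruct (Req_dec l 0) as [L | L];
    [destruct (Req_dec m 0) as [L' | L'] |].
  - right; right; apply Ext; intros x; rewrite Hw, coord_combo.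
    replace n with 1 by lra; rewrite L, L'; ring.
  - right; left; apply Ext; intros x; rewrite Hw, coord_combo.
    apply Rmult_integral in ZBC; destruct ZBC as [Z | Z]; [contradiction |].
    pose proof (N0 n B C Z x).
    replace m with (1 - n) by lra; rewrite L; lra.
  - left; apply Ext; intros x; rewrite Hw, coord_combo.
    apply Rmult_integral in ZAB; destruct ZAB as [Z | Z]; [contradiction |].
    apply Rmult_integral in ZAC; destruct ZAC as [Z' | Z']; [contradiction |].
    pose proof (N0 _ _ _ Z x); pose proof (N0 _ _ _ Z' x).
    replace l with (1 - m - n) by lra; lra.
Qed.

Lemma hull3_rot (A B C w : E3) : hull3 A B C w -> hull3 B C A w.
Proof.
  intros (l & m & n & Hl & Hm & Hn & Hs & Hw); exists m, n, l.
  repeat split; try lra.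
  apply (coord_ext _ _ _ _ _ axes_distinct);
    rewrite Hw, !coord_combo; ring.
Qed.

(** Solving the expression of [X] for [A] gives the weights [l / u], [m - l / u * v] and
    [n - l / u * r]; the last two hypotheses say that they are nonnegative. *)
Lemma hull3_exchange (A B C X : E3) (l m n u v r : R) :
  0 <= l -> 0 <= m -> 0 <= n -> l + m + n = 1 ->
  0 < u -> u + v + r = 1 -> X = combo u v r A B C ->
  l * v <= m * u -> l * r <= n * u ->
  hull3 X B C (combo l m n A B C).
Proof.
  intros Hl Hm Hn Hs Hu Hs' -> H1 H2.
  exists (l / u), (m - l / u * v), (n - l / u * r).
  assert (E : l / u * u = l) by (field; lra).
  assert (0 <= l / u) by (apply Rmult_le_pos; [lra |];
                          left; apply Rinv_0_lt_compat; lra).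
  repeat split; auto.
  - cut (l / u * v <= m); [lra | apply Rmult_le_reg_r with u; auto].
    replace (l / u * v * u) with (l * v) by (field; lra); exact H1.
  - cut (l / u * r <= n); [lra | apply Rmult_le_reg_r with u; auto].
    replace (l / u * r * u) with (l * r) by (field; lra); exact H2.
  - replace v with (1 - u - r) by lra; nra.
  - apply (coord_ext _ _ _ _ _ axes_distinct); rewrite !coord_combo;
      rewrite <- E at 1; ring.
Qed.

(** [X] replaces the vertex for which the ratio of the weight in [w] to the weight in [X] is least.
    [X] may lie on the boundary. *)
Lemma hull3_split (A B C X w : E3) : hull3 A B C X -> hull3 A B C w ->
  hull3 X B C w \/ hull3 A X C w \/ hull3 A B X w.
Proof.
  intros (u & v & r & Hu & Hv & Hr & HX & EX) (l & m & n & Hl & Hm & Hn & Hw & Ew).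
  assert (ExB : X = combo v r u B C A /\ w = combo m n l B C A).
  { split; apply (coord_ext _ _ _ _ _ axes_distinct);
      rewrite ?EX, ?Ew, !coord_combo; ring. }
  assert (ExC : X = combo r u v C A B /\ w = combo n l m C A B).
  { split; apply (coord_ext _ _ _ _ _ axes_distinct);
      rewrite ?EX, ?Ew, !coord_combo; ring. }
  destruct ExB as [EXB EwB], ExC as [EXC EwC].
  assert (CA : 0 < u -> l * v <= m * u -> l * r <= n * u -> hull3 X B C w)
    by (intros; rewrite Ew; apply (hull3_exchange A B C X l m n u v r); auto).
  assert (CB : 0 < v -> m * r <= n * v -> m * u <= l * v -> hull3 A X C w).
  { intros; apply hull3_rot, hull3_rot; rewrite EwB.
    apply (hull3_exchange B C A X m n l v r u); auto; lra. }
  assert (CC : 0 < r -> n * u <= l * r -> n * v <= m * r -> hull3 A B X w).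
  { intros; apply hull3_rot; rewrite EwC.
    apply (hull3_exchange C A B X n l m r u v); auto; lra. }
  destruct (Rle_lt_dec (l * v) (m * u)) as [H1 | H1],
    (Rle_lt_dec (l * r) (n * u)) as [H2 | H2],
    (Rle_lt_dec (m * r) (n * v)) as [H3 | H3];
    destruct Hu as [Hu | Hu]; try (left; apply CA; assumption);
    destruct Hv as [Hv | Hv]; try (right; left; apply CB; nra);
    destruct Hr as [Hr | Hr]; try (right; right; apply CC; nra);
    exfalso; nra.
Qed.

(** For a point on a side, [hull3_split] would leave a third, degenerate triangle on [A], [B] and
    [X]. *)
Lemma hull3_split_edge (A B C X w : E3) (u v : R) :
  0 <= u -> 0 <= v -> u + v = 1 -> X = combo u v 0 A B C -> hull3 A B C w ->
  hull3 X B C w \/ hull3 A X C w.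
Proof.
  intros Hu Hv HX EX (l & m & n & Hl & Hm & Hn & Hw & Ew).
  destruct (Rle_lt_dec (l * v) (m * u)) as [H1 | H1].
  - destruct Hu as [Hu | Hu].
    + left; rewrite Ew; apply (hull3_exchange A B C X l m n u v 0); auto; nra.
    + assert (l = 0) by nra; subst l.
      left; exists 0, m, n; repeat split; auto; try lra.
      apply (coord_ext _ _ _ _ _ axes_distinct); rewrite ?EX, ?Ew, !coord_combo;
        ring.
  - right; apply hull3_rot, hull3_rot.
    replace w with (combo m n l B C A)
      by (apply (coord_ext _ _ _ _ _ axes_distinct);
          rewrite ?EX, ?Ew, !coord_combo; ring).
    apply (hull3_exchange B C A X m n l v 0 u); auto; try lra; try nra.
    apply (coord_ext _ _ _ _ _ axes_distinct);
      rewrite ?EX, ?Ew, !coord_combo; ring.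
Qed.

(** Half the squared length of the vector with coordinates [u], [v], [- u - v]. *)
Definition norm2 (u v : R) : R := u ^ 2 + u * v + v ^ 2.

(* The points at equal distance along [i], [j], [k] and along [j], [i], [k]
   form a line, parametrized here by [l]. *)
Lemma dist_sq_first (i j k : axis) (p q : E3) (l : R) :
  coord i p + coord j p + coord k p = 1 ->
  coord i q = 1 - l * coord j p -> coord j q = 1 - l * coord i p ->
  coord k q = l * (coord i p + coord j p) - 1 ->
  dist_sq i j k p q = 2 * norm2 (coord i p) (coord j p) * (1 + l + l ^ 2).
Proof.
  intros Hs E1 E2 E3; unfold dist_sq, norm2; rewrite E1, E2, E3.
  replace (coord k p) with (1 - coord i p - coord j p) by lra; ring.
Qed.

(* Likewise for [i], [j], [k] and [i], [k], [j]. *)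
Lemma dist_sq_last (i j k : axis) (p q : E3) (l : R) :
  coord i p + coord j p + coord k p = 1 ->
  coord i q = 1 - l * (2 - coord j p - coord k p) ->
  coord j q = l * (1 - coord k p) -> coord k q = l * (1 - coord j p) ->
  dist_sq i j k p q =
  2 * norm2 (1 - coord j p) (1 - coord k p) * (1 + l + l ^ 2).
Proof.
  intros Hs E1 E2 E3; unfold dist_sq, norm2; rewrite E1, E2, E3.
  replace (coord i p) with (1 - coord j p - coord k p) by lra; ring.
Qed.

(** * The two candidates, their values and the other vertices of the cover *)

Definition e1 : E3 := (1, 0, 0).
Definition e2 : E3 := (0, 1, 0).
Definition e3 : E3 := (0, 0, 1).

(** The parameters at which the lines of [dist_sq_last] (orders 312, 321) and of [dist_sq_first]
    (orders 123, 213) meet the horizontal line of [dist_sq_line]. They are made homogeneous by means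
    of [a + b + c = 1]. *)
Definition left_param (a b c : R) : R := (a + 2 * b) / (a + 2 * b + 3 * c).
Definition right_param (a b c : R) : R := (2 * a + b + 3 * c) / (2 * a + b).

Definition left_max (a b c : R) : E3 :=
  let l := left_param a b c in (l * (a + c), l * (b + c), 1 - l * (1 + c)).
Definition right_max (a b c : R) : E3 :=
  let l := right_param a b c in (1 - l * b, 1 - l * a, l * (a + b) - 1).

Definition left_value (a b c : R) : R :=
  let l := left_param a b c in 2 * norm2 (a + c) (b + c) * (1 + l + l ^ 2).
Definition right_value (a b c : R) : R :=
  let l := right_param a b c in 2 * norm2 a b * (1 + l + l ^ 2).

Ltac positivity :=
  repeat first [assumption | lra | apply Rplus_le_le_0_compat
    | apply Rmult_le_pos | apply pow_le].

(* The polynomials below have nonnegative coefficients in [c], [b - c] and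
   [a - b]. *)
Ltac ordered_positivity a b c :=
  let x := fresh "x" in let y := fresh "y" in
  let Hx := fresh "Hx" in let Hy := fresh "Hy" in
  let Ex := fresh "Ex" in let Ey := fresh "Ey" in
  set (x := a - b); set (y := b - c);
  assert (Hx : 0 <= x) by (unfold x; lra);
  assert (Hy : 0 <= y) by (unfold y; lra);
  assert (Ey : b = c + y) by (unfold y; ring);
  assert (Ex : a = c + y + x) by (unfold x, y; ring);
  clearbody x y; rewrite Ex, Ey;
  match goal with |- 0 <= ?e => ring_simplify e end; positivity.

Lemma hull3_simplex (u v w : R) : 0 <= u -> 0 <= v -> 0 <= w ->
  u + v + w = 1 -> hull3 e1 e2 e3 (u, v, w).
Proof.
  intros; exists u, v, w; repeat split; auto.
  unfold combo, e1, e2, e3; f_equal; [f_equal |]; ring.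
Qed.

Set Default Proof Using "All".

Section Values.

Variables a b c : R.
Hypotheses (Hc : 0 <= c) (Hbc : c <= b) (Hab : b <= a) (Hs : a + b + c = 1).

Lemma left_value_eq : left_value a b c =
  2 * norm2 (a + c) (b + c) *
  ((a + 2 * b + 3 * c) ^ 2 + (a + 2 * b + 3 * c) * (a + 2 * b)
   + (a + 2 * b) ^ 2) / (a + 2 * b + 3 * c) ^ 2.
Proof. unfold left_value, left_param; field; lra. Qed.

Lemma right_value_eq : right_value a b c =
  2 * norm2 a b *
  ((2 * a + b + 3 * c) ^ 2 + (2 * a + b + 3 * c) * (2 * a + b)
   + (2 * a + b) ^ 2) / (2 * a + b) ^ 2.
Proof. unfold right_value, right_param; field; lra. Qed.

(** For a quadratic form [m] this compares homogeneous quartics, which [ordered_positivity] can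
    treat without the relation [a + b + c = 1]. *)
Lemma le_left_value (m : R) :
  m * (a + 2 * b + 3 * c) ^ 2 <= 2 * norm2 (a + c) (b + c) *
  ((a + 2 * b + 3 * c) ^ 2 + (a + 2 * b + 3 * c) * (a + 2 * b)
   + (a + 2 * b) ^ 2) -> m <= left_value a b c.
Proof.
  intros H; rewrite left_value_eq.
  assert (0 < (a + 2 * b + 3 * c) ^ 2) by (apply pow_lt; lra).
  apply Rmult_le_reg_r with ((a + 2 * b + 3 * c) ^ 2); auto.
  unfold Rdiv; rewrite (Rmult_assoc _ (/ _)), Rinv_l by lra.
  rewrite Rmult_1_r; exact H.
Qed.

Lemma le_right_value (m : R) :
  m * (2 * a + b) ^ 2 <= 2 * norm2 a b *
  ((2 * a + b + 3 * c) ^ 2 + (2 * a + b + 3 * c) * (2 * a + b)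
   + (2 * a + b) ^ 2) -> m <= right_value a b c.
Proof.
  intros H; rewrite right_value_eq.
  assert (0 < (2 * a + b) ^ 2) by (apply pow_lt; lra).
  apply Rmult_le_reg_r with ((2 * a + b) ^ 2); auto.
  unfold Rdiv; rewrite (Rmult_assoc _ (/ _)), Rinv_l by lra.
  rewrite Rmult_1_r; exact H.
Qed.

Lemma dist_sq_321_e2 : dist_sq ax3 ax2 ax1 (a, b, c) e2 <= left_value a b c.
Proof.
  replace (dist_sq ax3 ax2 ax1 (a, b, c) e2) with
    ((a + b + 2 * c) ^ 2 + b ^ 2 + (a + 2 * b + 2 * c) ^ 2)
    by (unfold dist_sq; simpl coord; replace a with (1 - b - c) by lra; ring).
  apply le_left_value, Rminus_le_0; unfold norm2.
  ordered_positivity a b c.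
Qed.

Lemma dist_sq_213_e2 : dist_sq ax2 ax1 ax3 (a, b, c) e2 < left_value a b c.
Proof.
  (* A slack of 1, written as [(a + b + c) ^ 2] below, reduces the strict inequality to a weak
     homogeneous one. *)
  apply Rlt_le_trans with (dist_sq ax2 ax1 ax3 (a, b, c) e2 + 1); [lra |].
  replace (dist_sq ax2 ax1 ax3 (a, b, c) e2 + 1) with
    ((a + 2 * b + c) ^ 2 + (b + c) ^ 2 + (a + b) ^ 2
     + (a + b + c) ^ 2)
    by (unfold dist_sq; simpl coord; replace a with (1 - b - c) by lra; ring).
  apply le_left_value, Rminus_le_0; unfold norm2.
  ordered_positivity a b c.
Qed.

Lemma left_param_pos : 0 < left_param a b c.
Proof. apply Rdiv_lt_0_compat; lra. Qed.

Lemma dist_sq_e3 (i j : axis) : (i, j) = (ax1, ax2) \/ (i, j) = (ax2, ax1) ->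
  dist_sq ax3 i j (a, b, c) e3 < left_value a b c.
Proof.
  intros H.
  replace (dist_sq ax3 i j (a, b, c) e3) with (2 * norm2 (a + c) (b + c)).
  - unfold left_value; rewrite <- (Rmult_1_r (2 * norm2 _ _)) at 1.
    apply Rmult_lt_compat_l.
    + apply Rmult_lt_0_compat; [lra |].
      unfold norm2; nra.
    + pose proof left_param_pos; nra.
  - unfold dist_sq, norm2; destruct H as [H | H]; injection H; intros -> ->;
      simpl coord; replace c with (1 - a - b) by lra; ring.
Qed.

(* The common point of the cells of the orders 312, 132, 123. *)
Definition right_vertex : E3 :=
  let l := c / (c * (a + c) + a * (1 + a)) in
  (1 - l * (1 + a), l * (a + b), l * (a + c)).

Definition right_vertex_value : R :=
  let l := c / (c * (a + c) + a * (1 + a)) in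
  2 * norm2 (a + b) (a + c) * (1 + l + l ^ 2).

Lemma right_vertex_value_lt : c < b -> right_vertex_value < right_value a b c.
Proof.
  intros Hlt.
  set (W := 2 * a ^ 2 + a * b + 2 * a * c + c ^ 2).
  assert (EW : c * (a + c) + a * (1 + a) = W)
    by (unfold W; replace b with (1 - a - c) by lra; ring).
  assert (PW : 0 < W) by (unfold W; nra).
  assert (PW2 : 0 < W ^ 2) by (apply pow_lt; exact PW).
  assert (PY : 0 < (2 * a + b) ^ 2) by (apply pow_lt; lra).
  assert (Py : 0 < (b - c) ^ 8) by (apply pow_lt; lra).
  unfold right_vertex_value; rewrite EW.
  replace (2 * norm2 (a + b) (a + c) * (1 + c / W + (c / W) ^ 2)) with
    (2 * norm2 (a + b) (a + c) *
     (W ^ 2 + c * (a + b + c) * W + (c * (a + b + c)) ^ 2) / W ^ 2)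
    by (rewrite Hs; field; lra).
  rewrite right_value_eq.
  apply Rmult_lt_reg_r with (W ^ 2 * (2 * a + b) ^ 2);
    [apply Rmult_lt_0_compat; assumption |].
  match goal with |- ?u / _ * _ < ?v / _ * _ =>
    replace (u / W ^ 2 * (W ^ 2 * (2 * a + b) ^ 2)) with (u * (2 * a + b) ^ 2)
      by (field; lra);
    replace (v / (2 * a + b) ^ 2 * (W ^ 2 * (2 * a + b) ^ 2)) with (v * W ^ 2)
      by (field; lra);
    (* The products have degree 8, so [(b - c) ^ 8] is a homogeneous margin; it is positive for
       [c < b]. *)
    cut (0 <= v * W ^ 2 - u * (2 * a + b) ^ 2 - (b - c) ^ 8); [lra |]
  end.
  clear Hlt EW PW PW2 PY Py; unfold W, norm2; clear W.
  ordered_positivity a b c.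
Qed.

Lemma right_vertex_eq : b = c -> right_vertex = right_max a b c.
Proof.
  intros E; unfold right_vertex, right_max, right_param.
  assert (Ea : a = 1 - 2 * c) by lra; rewrite E, Ea.
  assert (0 < c * (1 - 2 * c + c) + (1 - 2 * c) * (1 + (1 - 2 * c))) by nra.
  f_equal; [f_equal |]; field; split; try lra.
Qed.

(** The candidates arise from the point itself by horizontal moves in opposite directions. Both
    moves vanish when [c = 0] or [a = b]. *)
Definition left_shift : R := 2 * c * (a - b) / (a + 2 * b + 3 * c).
Definition right_shift : R := 2 * c * (a - b) / (2 * a + b).

Lemma left_max_shift : left_max a b c =
  (a - left_shift, b + left_shift / 2, c + left_shift / 2).
Proof.
  unfold left_max, left_param, left_shift.
  f_equal; [f_equal |]; apply Rmult_eq_reg_r with (a + 2 * b + 3 * c); try lra;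
    field_simplify; try lra; replace a with (1 - b - c) by lra; ring.
Qed.

Lemma right_max_shift : right_max a b c =
  (a + right_shift, b - right_shift / 2, c - right_shift / 2).
Proof.
  unfold right_max, right_param, right_shift.
  f_equal; [f_equal |]; apply Rmult_eq_reg_r with (2 * a + b); try lra;
    field_simplify; try lra; replace a with (1 - b - c) by lra; ring.
Qed.

Lemma left_shift_bounds : 0 <= left_shift <= a.
Proof.
  split; [apply Rdiv_le_0_compat; nra |].
  apply Rle_div_l; nra.
Qed.

Lemma right_shift_bounds : 0 <= right_shift <= c.
Proof.
  split; [apply Rdiv_le_0_compat; nra |].
  apply Rle_div_l; nra.
Qed.

(** The images for the orders 312 and 213 are symmetric in the horizontal line through [p]. This is
    why both candidates, and hence [f], keep the height of [p]. *)
Lemma dist_sq_line (q : E3) :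
  coord ax1 q + coord ax2 q + coord ax3 q = 1 ->
  coord ax2 q - coord ax3 q = b - c ->
  dist_sq ax3 ax1 ax2 (a, b, c) q = dist_sq ax2 ax1 ax3 (a, b, c) q.
Proof.
  intros H1 H2; unfold dist_sq; simpl coord.
  replace (coord ax3 q) with (coord ax2 q - b + c) in * by lra.
  replace (coord ax1 q) with (1 - 2 * coord ax2 q + b - c) in * by lra.
  replace a with (1 - b - c) by lra; ring.
Qed.

Lemma left_max_sum : coord ax1 (left_max a b c) + coord ax2 (left_max a b c)
  + coord ax3 (left_max a b c) = 1.
Proof. rewrite left_max_shift; simpl; lra. Qed.

Lemma right_max_sum : coord ax1 (right_max a b c) + coord ax2 (right_max a b c)
  + coord ax3 (right_max a b c) = 1.
Proof. rewrite right_max_shift; simpl; lra. Qed.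

Lemma dist_sq_left_max :
  dist_sq ax3 ax2 ax1 (a, b, c) (left_max a b c) = left_value a b c /\
  dist_sq ax3 ax1 ax2 (a, b, c) (left_max a b c) = left_value a b c /\
  dist_sq ax2 ax1 ax3 (a, b, c) (left_max a b c) = left_value a b c.
Proof.
  assert (E : dist_sq ax3 ax1 ax2 (a, b, c) (left_max a b c)
              = left_value a b c).
  { rewrite (dist_sq_last _ _ _ _ _ (left_param a b c));
      unfold left_max; simpl coord; try lra;
      try (generalize (left_param a b c); intros l;
           replace a with (1 - b - c) by lra; ring).
    unfold left_value, norm2.
    replace (1 - b) with (a + c) by lra; replace (1 - a) with (b + c) by lra.
    ring. }
  split; [| split; [exact E |]].
  - rewrite (dist_sq_last _ _ _ _ _ (left_param a b c));
      unfold left_max; simpl coord; try lra;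
      try (generalize (left_param a b c); intros l;
           replace a with (1 - b - c) by lra; ring).
    unfold left_value, norm2.
    replace (1 - b) with (a + c) by lra; replace (1 - a) with (b + c) by lra.
    ring.
  - rewrite <- dist_sq_line; [exact E | apply left_max_sum |].
    rewrite left_max_shift; simpl; lra.
Qed.

Lemma dist_sq_right_max :
  dist_sq ax1 ax2 ax3 (a, b, c) (right_max a b c) = right_value a b c /\
  dist_sq ax2 ax1 ax3 (a, b, c) (right_max a b c) = right_value a b c /\
  dist_sq ax3 ax1 ax2 (a, b, c) (right_max a b c) = right_value a b c.
Proof.
  assert (E : dist_sq ax2 ax1 ax3 (a, b, c) (right_max a b c)
              = right_value a b c).
  { rewrite (dist_sq_first _ _ _ _ _ (right_param a b c));
      unfold right_max; simpl coord; try lra.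
    unfold right_value, norm2; ring. }
  split; [| split; [exact E |]].
  - rewrite (dist_sq_first _ _ _ _ _ (right_param a b c));
      unfold right_max; simpl coord; try lra; reflexivity.
  - rewrite dist_sq_line; [exact E | apply right_max_sum |].
    rewrite right_max_shift; simpl; lra.
Qed.

(* Where the lines [dist_sq ax1 ax2 ax3 = dist_sq ax2 ax1 ax3] and
   [dist_sq ax1 ax3 ax2 = dist_sq ax3 ax1 ax2] leave the triangle. *)
Definition edge12 : E3 :=
  let l := / (a + b) in (1 - l * b, 1 - l * a, l * (a + b) - 1).
Definition edge13 : E3 :=
  let l := / (a + c) in (1 - l * c, l * (a + c) - 1, 1 - l * a).

(** [edge12] and [right_max] lie on one line of [dist_sq_first], along which the value increases
    with the parameter; the parameter of [right_max] is the larger one if [0 < c]. *)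
Lemma dist_sq_edge12 (i j : axis) :
  (i, j) = (ax1, ax2) \/ (i, j) = (ax2, ax1) ->
  dist_sq i j ax3 (a, b, c) edge12 <= right_value a b c /\
  (0 < c -> dist_sq i j ax3 (a, b, c) edge12 < right_value a b c).
Proof.
  intros H.
  replace (dist_sq i j ax3 (a, b, c) edge12) with
    (2 * norm2 a b * (1 + / (a + b) + (/ (a + b)) ^ 2)).
  2: { destruct H as [H | H]; injection H; intros -> ->;
       rewrite (dist_sq_first _ _ _ _ _ (/ (a + b)));
       unfold edge12, norm2; simpl coord; try lra. }
  unfold right_value.
  assert (P : 0 < / (a + b)) by (apply Rinv_0_lt_compat; lra).
  assert (N : 0 < 2 * norm2 a b) by (unfold norm2; nra).
  assert (E : right_param a b c =
              / (a + b) + c * (a + 2 * b) * (/ (a + b) * / (2 * a + b))).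
  { unfold right_param; apply Rmult_eq_reg_r with ((2 * a + b) * (a + b));
      [| nra].
    field_simplify; try lra.
    replace c with (1 - a - b) by lra; ring. }
  assert (0 < / (a + b) * / (2 * a + b))
    by (apply Rmult_lt_0_compat; apply Rinv_0_lt_compat; lra).
  assert (A : / (a + b) <= right_param a b c).
  { rewrite E.
    assert (0 <= c * (a + 2 * b) * (/ (a + b) * / (2 * a + b)));
      [| lra].
    apply Rmult_le_pos; [| lra]; apply Rmult_le_pos; lra. }
  split.
  - apply Rmult_le_compat_l; [lra |]; nra.
  - intros C; apply Rmult_lt_compat_l; [lra |].
    assert (/ (a + b) < right_param a b c); [| nra].
    rewrite E.
    assert (0 < c * (a + 2 * b) * (/ (a + b) * / (2 * a + b))); [| lra].
    apply Rmult_lt_0_compat; [| lra]; apply Rmult_lt_0_compat; lra.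
Qed.

Lemma right_vertex_denominator : 0 < c * (a + c) + a * (1 + a).
Proof. nra. Qed.

Lemma dist_sq_right_vertex :
  dist_sq ax1 ax2 ax3 (a, b, c) right_vertex = right_vertex_value /\
  dist_sq ax1 ax3 ax2 (a, b, c) right_vertex = right_vertex_value /\
  dist_sq ax3 ax1 ax2 (a, b, c) right_vertex = right_vertex_value.
Proof.
  pose proof right_vertex_denominator as W.
  assert (E : dist_sq ax1 ax3 ax2 (a, b, c) right_vertex = right_vertex_value).
  { rewrite (dist_sq_last _ _ _ _ _ (c / (c * (a + c) + a * (1 + a))));
      unfold right_vertex; simpl coord; try lra;
      try (generalize (c / (c * (a + c) + a * (1 + a))); intros l;
           replace a with (1 - b - c) by lra; ring).
    unfold right_vertex_value, norm2.
    replace (1 - b) with (a + c) by lra; replace (1 - c) with (a + b) by lra.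
    ring. }
  split; [| split; [exact E |]].
  - rewrite (dist_sq_last _ _ _ _ _ (c / (c * (a + c) + a * (1 + a))));
      unfold right_vertex; simpl coord; try lra;
      try (generalize (c / (c * (a + c) + a * (1 + a))); intros l;
           replace a with (1 - b - c) by lra; ring).
    unfold right_vertex_value, norm2.
    replace (1 - b) with (a + c) by lra; replace (1 - c) with (a + b) by lra.
    ring.
  - rewrite <- E.
    (* The parameter of the same point on the line where the orders 132 and 312 agree. *)
    set (l := (1 + a) / (c * (a + c) + a * (1 + a))).
    assert (H1 : 1 - c / (c * (a + c) + a * (1 + a)) * (1 + a) = 1 - l * c)
      by (unfold l; field; lra).
    assert (H2 : c / (c * (a + c) + a * (1 + a)) * (a + b) = l * (a + c) - 1).
    { unfold l; replace b with (1 - a - c) by lra; field; lra. }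
    assert (H3 : c / (c * (a + c) + a * (1 + a)) * (a + c) = 1 - l * a).
    { unfold l; field; lra. }
    rewrite !(dist_sq_first _ _ _ _ _ l); unfold right_vertex; simpl coord;
      try lra; unfold norm2; ring.
Qed.

Lemma right_vertex_value_le : right_vertex_value <= right_value a b c.
Proof.
  destruct Hbc as [H | H].
  - left; apply right_vertex_value_lt; exact H.
  - right; rewrite <- (proj1 dist_sq_right_vertex), <- (proj1 dist_sq_right_max).
    rewrite right_vertex_eq by auto; reflexivity.
Qed.

Lemma dist_sq_edge13 (i j : axis) :
  (i, j) = (ax1, ax3) \/ (i, j) = (ax3, ax1) ->
  dist_sq i j ax2 (a, b, c) edge13 <= right_vertex_value /\
  (0 < c -> dist_sq i j ax2 (a, b, c) edge13 < right_vertex_value).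
Proof.
  intros H; pose proof right_vertex_denominator as W.
  replace (dist_sq i j ax2 (a, b, c) edge13) with
    (2 * norm2 a c * (1 + / (a + c) + (/ (a + c)) ^ 2)).
  2: { destruct H as [H | H]; injection H; intros -> ->;
       rewrite (dist_sq_first _ _ _ _ _ (/ (a + c)));
       unfold edge13, norm2; simpl coord; try lra. }
  set (l := (1 + a) / (c * (a + c) + a * (1 + a))).
  replace right_vertex_value with (2 * norm2 a c * (1 + l + l ^ 2)).
  2: { rewrite <- (proj1 (proj2 dist_sq_right_vertex)).
       symmetry; apply (dist_sq_first ax1 ax3 ax2); unfold right_vertex;
         simpl coord; try lra; unfold l; [field; lra .. |].
       replace b with (1 - a - c) by lra; field; lra. }
  assert (P : 0 < / (a + c)) by (apply Rinv_0_lt_compat; lra).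
  assert (N : 0 < 2 * norm2 a c) by (unfold norm2; nra).
  (* The two terms with [c * b] cancel: [l] exceeds [/ (a + c)] by the term with [c * (1 - c)]. *)
  assert (E : l = / (a + c) + c * b *
                  (/ (a + c) * / (c * (a + c) + a * (1 + a)))
                  + c * (1 - c) * (/ (a + c) * / (c * (a + c) + a * (1 + a)))
                  - c * b * (/ (a + c) * / (c * (a + c) + a * (1 + a)))).
  { unfold l; field; split; lra. }
  assert (Q : 0 < / (a + c) * / (c * (a + c) + a * (1 + a)))
    by (apply Rmult_lt_0_compat; apply Rinv_0_lt_compat; lra).
  set (d := / (a + c) * / (c * (a + c) + a * (1 + a))) in *.
  assert (A : / (a + c) <= l).
  { assert (0 <= c * (1 - c) * d); [| lra].
    apply Rmult_le_pos; [| lra]; apply Rmult_le_pos; lra. }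
  split.
  - apply Rmult_le_compat_l; [lra |]; nra.
  - intros C; apply Rmult_lt_compat_l; [lra |].
    assert (/ (a + c) < l); [| nra].
    assert (0 < c * (1 - c) * d); [| lra].
    apply Rmult_lt_0_compat; [| lra]; apply Rmult_lt_0_compat; lra.
Qed.

End Values.

(** * Comparison of the six orders and the cover of the first face *)

Lemma dist_sq_swap_last (i j k : axis) (p q : E3) :
  coord i p + coord j p + coord k p = 1 ->
  coord i q + coord j q + coord k q = 1 ->
  dist_sq i j k p q - dist_sq i k j p q =
  6 * (coord k q * (1 - coord k p) - coord j q * (1 - coord j p)).
Proof.
  intros H1 H2; unfold dist_sq.
  replace (coord i p) with (1 - coord k p - coord j p) by lra.
  replace (coord i q) with (1 - coord k q - coord j q) by lra; ring.
Qed.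

Lemma dist_sq_swap_ends (i j k : axis) (p q : E3) :
  coord i p + coord j p + coord k p = 1 ->
  coord i q + coord j q + coord k q = 1 ->
  dist_sq i j k p q - dist_sq k j i p q =
  6 * ((coord i p - coord k p) - (coord i q - coord k q)).
Proof.
  intros H1 H2; unfold dist_sq.
  replace (coord j p) with (1 - coord k p - coord i p) by lra.
  replace (coord j q) with (1 - coord k q - coord i q) by lra; ring.
Qed.

Section Maximum.

Variables a b c : R.
Hypotheses (Hc : 0 <= c) (Hbc : c <= b) (Hab : b <= a) (Hs : a + b + c = 1).

Definition max_value : R := Rmax (left_value a b c) (right_value a b c).

Lemma right_max_hull : hull3 e1 e2 e3 (right_max a b c).
Proof.
  rewrite right_max_shift by assumption.
  destruct (right_shift_bounds a b c) as [H H']; try assumption.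
  apply hull3_simplex; lra.
Qed.

Lemma left_max_hull : hull3 (right_max a b c) e2 e3 (left_max a b c).
Proof.
  rewrite right_max_shift, left_max_shift by assumption.
  destruct (right_shift_bounds a b c) as [H H']; try assumption.
  destruct (left_shift_bounds a b c) as [H0 H1]; try assumption.
  set (d := left_shift a b c) in *; set (d' := right_shift a b c) in *.
  (* [e2] and [e3] have first coordinate 0, so the weight of [right_max] is the ratio of the first
     coordinates. *)
  assert (E : (a - d) / (a + d') * (a + d') = a - d) by (field; lra).
  assert (H2 : 0 <= (a - d) / (a + d') <= 1).
  { split; [apply Rdiv_le_0_compat | apply Rle_div_l]; lra. }
  set (k := (a - d) / (a + d')) in *.
  exists k, (b + d / 2 - k * (b - d' / 2)), (c + d / 2 - k * (c - d' / 2)).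
  repeat split; try lra; try nra.
  unfold combo, e2, e3; f_equal; [f_equal |]; lra.
Qed.

Lemma right_vertex_hull :
  hull3 e1 (right_max a b c) e3 (right_vertex a b c).
Proof.
  assert (W := right_vertex_denominator a b c Hc Hbc Hab Hs).
  destruct (Req_dec c 0) as [C | C].
  - exists 1, 0, 0; repeat split; try lra.
    unfold right_vertex; rewrite C; unfold Rdiv; rewrite Rmult_0_l.
    unfold combo, e1, e3; destruct (right_max a b 0) as [[? ?] ?].
    f_equal; [f_equal |]; ring.
  - set (B := 2 * a * b + b ^ 2 - a * c + b * c).
    assert (HB : 0 < B) by (unfold B; nra).
    set (w := 2 * a ^ 2 + a * b + 2 * a * c + c ^ 2).
    assert (Ew : c * (a + c) + a * (1 + a) = w)
      by (unfold w; replace b with (1 - a - c) by lra; ring).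
    assert (HY : 0 < 2 * a + b) by lra.
    assert (HP : 0 < / (w * B))
      by (apply Rinv_0_lt_compat, Rmult_lt_0_compat; lra).
    rewrite Ew in W.
    assert (R1 : right_max a b c =
      ((2 * a ^ 2 + a * b + 2 * a * c - 2 * b * c) / (2 * a + b),
       B / (2 * a + b), c * (a + 2 * b) / (2 * a + b))).
    { unfold right_max, right_param, B.
      f_equal; [f_equal |]; apply Rmult_eq_reg_r with (2 * a + b); try lra;
        field_simplify; try lra; replace a with (1 - b - c) by lra; ring. }
    rewrite R1; unfold right_vertex; rewrite Ew.
    (* The second coordinates determine the weight of [right_max], as [e1] and [e3] have second
       coordinate 0; the first and third coordinates then give the other two weights. *)
    exists ((w * B - c * (2 * a + b + c) * B
             - c * (a + b) * (2 * a ^ 2 + a * b + 2 * a * c - 2 * b * c))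
            * / (w * B)),
      (c * (a + b) * (2 * a + b) * / (w * B)),
      (c * ((a + c) * B - (a + b) * (c * (a + 2 * b))) * / (w * B)).
    repeat split.
    + apply Rmult_le_pos; [| lra]; unfold w, B; clear - Hc Hbc Hab.
      ordered_positivity a b c.
    + apply Rmult_le_pos; [| lra]; positivity.
    + apply Rmult_le_pos; [| lra]; apply Rmult_le_pos; [lra |].
      unfold B; clear - Hc Hbc Hab.
      ordered_positivity a b c.
    + rewrite <- !Rmult_plus_distr_r.
      apply Rmult_eq_reg_r with (w * B); [| nra].
      rewrite Rmult_assoc, Rinv_l by nra; unfold w, B.
      replace a with (1 - b - c) by lra; ring.
    + unfold combo, e1, e3; f_equal; [f_equal |].
      * replace (1 + a) with (2 * a + b + c) by lra; field; lra.
      * field; lra.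
      * field; lra.
Qed.

Lemma edge12_eq : edge12 a b =
  combo (a / (a + b)) (b / (a + b)) 0 e1 e2 (right_max a b c).
Proof.
  destruct (right_max a b c) as [[? ?] ?].
  unfold edge12, combo, e1, e2; f_equal; [f_equal |]; field; lra.
Qed.

Lemma edge13_eq : edge13 a c =
  combo (c / (a + c)) (a / (a + c)) 0 e3 e1 (right_vertex a b c).
Proof.
  destruct (right_vertex a b c) as [[? ?] ?].
  unfold edge13, combo, e1, e3; f_equal; [f_equal |]; field; lra.
Qed.

(** The candidates are exempt from the strict bound so that vertices of the cover which degenerate
    into a candidate, for [c = 0] or [b = c], satisfy it as well. *)
Definition below_max (w : E3) : Prop :=
  w = left_max a b c \/ w = right_max a b c \/
  exists i j k, distinct i j k /\ dist_sq i j k (a, b, c) w < max_value.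

Lemma below_max_intro (i j k : axis) (w : E3) : distinct i j k ->
  dist_sq i j k (a, b, c) w < max_value -> below_max w.
Proof. intros D H; right; right; exists i, j, k; auto. Qed.

Lemma left_value_le_max : left_value a b c <= max_value.
Proof. apply Rmax_l. Qed.

Lemma right_value_le_max : right_value a b c <= max_value.
Proof. apply Rmax_r. Qed.

Lemma dist_sq_e1 (j k : axis) : (j, k) = (ax2, ax3) \/ (j, k) = (ax3, ax2) ->
  dist_sq ax1 j k (a, b, c) e1 <= right_vertex_value a b c /\
  (0 < c -> dist_sq ax1 j k (a, b, c) e1 < right_vertex_value a b c).
Proof.
  intros H; assert (W := right_vertex_denominator a b c Hc Hbc Hab Hs).
  replace (dist_sq ax1 j k (a, b, c) e1) with (2 * norm2 (a + b) (a + c)).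
  2: { destruct H as [H | H]; injection H; intros -> ->;
       unfold dist_sq, norm2; simpl coord; replace a with (1 - b - c) by lra;
       ring. }
  unfold right_vertex_value; set (l := c / _).
  assert (N : 0 < 2 * norm2 (a + b) (a + c)) by (unfold norm2; nra).
  set (n := 2 * norm2 _ _) in *.
  replace (n * (1 + l + l ^ 2)) with (n + n * (l + l ^ 2)) by ring.
  split; [| intros C].
  - assert (0 <= l) by (apply Rdiv_le_0_compat; lra).
    assert (0 <= n * (l + l ^ 2)) by (apply Rmult_le_pos; nra); lra.
  - assert (0 < l) by (apply Rdiv_lt_0_compat; lra).
    assert (0 < n * (l + l ^ 2)) by (apply Rmult_lt_0_compat; nra); lra.
Qed.

Lemma right_vertex_below : below_max (right_vertex a b c).
Proof.
  destruct Hbc as [H | H].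
  - apply (below_max_intro ax1 ax2 ax3); [apply axes_distinct |].
    destruct (dist_sq_right_vertex a b c) as (-> & _); auto.
    apply Rlt_le_trans with (2 := right_value_le_max).
    apply right_vertex_value_lt; assumption.
  - right; left; apply right_vertex_eq; auto.
Qed.

Lemma e1_below : below_max e1.
Proof.
  destruct (Rle_lt_or_eq_dec _ _ Hc) as [H | H].
  - apply (below_max_intro ax1 ax2 ax3); [apply axes_distinct |].
    apply Rlt_le_trans with (2 := right_value_le_max).
    apply Rlt_le_trans with (2 := right_vertex_value_le a b c Hc Hbc Hab Hs).
    apply dist_sq_e1; auto.
  - replace e1 with (right_vertex a b c); [apply right_vertex_below |].
    unfold right_vertex, e1; rewrite <- H; unfold Rdiv.
    f_equal; [f_equal |]; ring.
Qed.

Lemma edge12_below : below_max (edge12 a b).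
Proof.
  destruct (Rle_lt_or_eq_dec _ _ Hc) as [H | H].
  - apply (below_max_intro ax1 ax2 ax3); [apply axes_distinct |].
    apply Rlt_le_trans with (2 := right_value_le_max).
    apply dist_sq_edge12; auto.
  - right; left.
    unfold edge12, right_max, right_param.
    replace (2 * a + b + 3 * c) with (2 * a + b) by lra.
    rewrite Rdiv_diag by lra; replace (a + b) with 1 by lra.
    rewrite Rinv_1; reflexivity.
Qed.

Lemma edge13_below : below_max (edge13 a c).
Proof.
  destruct (Rle_lt_or_eq_dec _ _ Hc) as [H | H].
  - apply (below_max_intro ax1 ax3 ax2); [repeat split; discriminate |].
    apply Rlt_le_trans with (2 := right_value_le_max).
    apply Rlt_le_trans with (2 := right_vertex_value_le a b c Hc Hbc Hab Hs).
    apply dist_sq_edge13; auto.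
  - replace (edge13 a c) with e1; [apply e1_below |].
    unfold edge13, e1; rewrite <- H.
    f_equal; [f_equal |]; field; lra.
Qed.

Lemma e2_below : below_max e2.
Proof.
  apply (below_max_intro ax2 ax1 ax3); [repeat split; discriminate |].
  apply Rlt_le_trans with (2 := left_value_le_max).
  apply dist_sq_213_e2; auto.
Qed.

Lemma e3_below : below_max e3.
Proof.
  apply (below_max_intro ax3 ax1 ax2); [repeat split; discriminate |].
  apply Rlt_le_trans with (2 := left_value_le_max).
  apply dist_sq_e3; auto.
Qed.

Lemma left_max_below : below_max (left_max a b c).
Proof. left; reflexivity. Qed.

Lemma right_max_below : below_max (right_max a b c).
Proof. right; left; reflexivity. Qed.

Lemma disc_below (i j k : axis) (A B C w : E3) : distinct i j k ->
  dist_sq i j k (a, b, c) A <= max_value ->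
  dist_sq i j k (a, b, c) B <= max_value ->
  dist_sq i j k (a, b, c) C <= max_value ->
  below_max A -> below_max B -> below_max C ->
  hull3 A B C w -> below_max w.
Proof.
  intros D HA HB HC IA IB IC Hw.
  destruct (disc_triangle i j k _ A B C w _ D HA HB HC Hw)
    as [H | [-> | [-> | ->]]]; auto.
  apply (below_max_intro i j k); auto.
Qed.

(** The cover has nine triangles. The first cut is at [right_max]; the part on [e2], [e3] is cut at
    [left_max], the part on [e1], [e3] at [right_vertex]. The triangles that then contain the sides
    from [e1] to [e2] and from [e1] to [e3] are cut at [edge12] and [edge13], where the order in use
    changes. *)
Lemma simplex_below (w : E3) : hull3 e1 e2 e3 w -> below_max w.
Proof.
  intros Hw.
  pose proof left_value_le_max as ML; pose proof right_value_le_max as MR.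
  pose proof (right_vertex_value_le a b c Hc Hbc Hab Hs) as MV.
  destruct (dist_sq_left_max a b c) as (L1 & L2 & L3); auto.
  destruct (dist_sq_right_max a b c) as (R1 & R2 & R3); auto.
  destruct (dist_sq_right_vertex a b c) as (V1 & V2 & V3); auto.
  pose proof (dist_sq_321_e2 a b c Hc Hbc Hab Hs) as E21.
  pose proof (dist_sq_213_e2 a b c Hc Hbc Hab Hs) as E22.
  pose proof (dist_sq_e3 a b c Hc Hbc Hab Hs ax1 ax2 (or_introl eq_refl)) as E31.
  pose proof (dist_sq_e3 a b c Hc Hbc Hab Hs ax2 ax1 (or_intror eq_refl)) as E32.
  destruct (dist_sq_e1 ax2 ax3 (or_introl eq_refl)) as [E11 _].
  destruct (dist_sq_e1 ax3 ax2 (or_intror eq_refl)) as [E12 _].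
  destruct (dist_sq_edge12 a b c Hc Hbc Hab Hs ax1 ax2 (or_introl eq_refl))
    as [S1 _].
  destruct (dist_sq_edge12 a b c Hc Hbc Hab Hs ax2 ax1 (or_intror eq_refl))
    as [S2 _].
  destruct (dist_sq_edge13 a b c Hc Hbc Hab Hs ax1 ax3 (or_introl eq_refl))
    as [T1 _].
  destruct (dist_sq_edge13 a b c Hc Hbc Hab Hs ax3 ax1 (or_intror eq_refl))
    as [T2 _].
  pose proof left_max_below as G1; pose proof right_max_below as G2.
  pose proof e1_below as G3; pose proof e2_below as G4.
  pose proof e3_below as G5; pose proof edge12_below as G6.
  pose proof edge13_below as G7; pose proof right_vertex_below as G8.
  assert (Pab : 0 <= / (a + b)) by (left; apply Rinv_0_lt_compat; lra).
  assert (Pac : 0 <= / (a + c)) by (left; apply Rinv_0_lt_compat; lra).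
  destruct (hull3_split _ _ _ _ _ right_max_hull Hw) as [H1 | [H1 | H1]].
  - destruct (hull3_split _ _ _ _ _ left_max_hull H1) as [H2 | [H2 | H2]].
    + apply (disc_below ax3 ax2 ax1) with (8 := H2); auto; try lra.
      repeat split; discriminate.
    + apply (disc_below ax3 ax1 ax2) with (8 := H2); auto; try lra.
      repeat split; discriminate.
    + apply (disc_below ax2 ax1 ax3) with (8 := H2); auto; try lra.
      repeat split; discriminate.
  - destruct (hull3_split _ _ _ _ _ right_vertex_hull H1) as [H2 | [H2 | H2]].
    + apply (disc_below ax3 ax1 ax2) with (8 := H2); auto; try lra.
      repeat split; discriminate.
    + apply hull3_rot, hull3_rot in H2.
      destruct (hull3_split_edge e3 e1 (right_vertex a b c) (edge13 a c) w
                  (c / (a + c)) (a / (a + c))) as [H3 | H3]; auto.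
      * apply Rmult_le_pos; lra.
      * apply Rmult_le_pos; lra.
      * field; lra.
      * apply edge13_eq.
      * apply (disc_below ax1 ax3 ax2) with (8 := H3); auto; try lra.
        repeat split; discriminate.
      * apply (disc_below ax3 ax1 ax2) with (8 := H3); auto; try lra.
        repeat split; discriminate.
    + apply (disc_below ax1 ax2 ax3) with (8 := H2); auto; try lra.
      repeat split; discriminate.
  - destruct (hull3_split_edge e1 e2 (right_max a b c) (edge12 a b) w
                  (a / (a + b)) (b / (a + b))) as [H2 | H2]; auto.
    + apply Rmult_le_pos; lra.
    + apply Rmult_le_pos; lra.
    + field; lra.
    + apply edge12_eq.
    + apply (disc_below ax2 ax1 ax3) with (8 := H2); auto; try lra.
      repeat split; discriminate.
    + apply (disc_below ax1 ax2 ax3) with (8 := H2); auto; try lra.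
      repeat split; discriminate.
Qed.

(** The orders 321, 312, 213 attain the value. The swap identities give that 123 is at least 321,
    that 132 is at least 123 and that 231 is at least 213. *)
Lemma left_value_min (i j k : axis) : distinct i j k ->
  left_value a b c <= dist_sq i j k (a, b, c) (left_max a b c).
Proof.
  intros D.
  destruct (dist_sq_left_max a b c) as (L1 & L2 & L3); auto.
  assert (Sq : coord ax1 (left_max a b c) + coord ax2 (left_max a b c)
               + coord ax3 (left_max a b c) = 1)
    by (apply left_max_sum; auto).
  pose proof (dist_sq_swap_ends ax1 ax2 ax3 (a, b, c) (left_max a b c)) as H1.
  pose proof (dist_sq_swap_last ax1 ax2 ax3 (a, b, c) (left_max a b c)) as H2.
  pose proof (dist_sq_swap_last ax2 ax1 ax3 (a, b, c) (left_max a b c)) as H3.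
  rewrite left_max_shift in * by auto.
  destruct (left_shift_bounds a b c) as [B0 B1]; auto.
  set (d := left_shift a b c) in *; simpl coord in *.
  specialize (H1 ltac:(lra) ltac:(lra)); specialize (H2 ltac:(lra) ltac:(lra));
  specialize (H3 ltac:(lra) ltac:(lra)).
  assert (X : 0 <= (b - c) * (a - d / 2)) by (apply Rmult_le_pos; lra).
  assert (Y : (b + d / 2) * (1 - b) - (c + d / 2) * (1 - c) =
              (b - c) * (a - d / 2))
    by (replace a with (1 - b - c) by lra; field).
  assert (Z : (a - d) * (1 - a) = (b + d / 2) * (1 - b)).
  { pose proof (dist_sq_swap_last ax3 ax1 ax2 (a, b, c)
      (a - d, b + d / 2, c + d / 2)) as H4; simpl coord in H4.
    specialize (H4 ltac:(lra) ltac:(lra)); lra. }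
  destruct D as (D1 & D2 & D3); destruct i, j, k; try congruence; lra.
Qed.

(** Here 123, 213, 312 attain the value, and 321 and 132 are compared with 123, and 231 with 213. *)
Lemma right_value_min (i j k : axis) : distinct i j k ->
  right_value a b c <= dist_sq i j k (a, b, c) (right_max a b c).
Proof.
  intros D.
  destruct (dist_sq_right_max a b c) as (L1 & L2 & L3); auto.
  assert (Sq : coord ax1 (right_max a b c) + coord ax2 (right_max a b c)
               + coord ax3 (right_max a b c) = 1)
    by (apply right_max_sum; auto).
  pose proof (dist_sq_swap_ends ax1 ax2 ax3 (a, b, c) (right_max a b c)) as H1.
  pose proof (dist_sq_swap_last ax1 ax2 ax3 (a, b, c) (right_max a b c)) as H2.
  pose proof (dist_sq_swap_last ax2 ax1 ax3 (a, b, c) (right_max a b c)) as H3.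
  rewrite right_max_shift in * by auto.
  destruct (right_shift_bounds a b c) as [B0 B1]; auto.
  set (d := right_shift a b c) in *; simpl coord in *.
  specialize (H1 ltac:(lra) ltac:(lra)); specialize (H2 ltac:(lra) ltac:(lra));
  specialize (H3 ltac:(lra) ltac:(lra)).
  assert (X : 0 <= (b - c) * (a + d / 2)) by (apply Rmult_le_pos; lra).
  assert (Y : (b - d / 2) * (1 - b) - (c - d / 2) * (1 - c) =
              (b - c) * (a + d / 2))
    by (replace a with (1 - b - c) by lra; field).
  assert (X' : 0 <= (a - c) * b) by (apply Rmult_le_pos; lra).
  assert (Z : (a + d) * (1 - a) - (c - d / 2) * (1 - c) =
              (a - c) * b + d * (1 - a) + d / 2 * (1 - c))
    by (replace b with (1 - a - c) by lra; field).
  assert (0 <= d * (1 - a)) by (apply Rmult_le_pos; lra).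
  assert (0 <= d / 2 * (1 - c)) by (apply Rmult_le_pos; lra).
  destruct D as (D1 & D2 & D3); destruct i, j, k; try congruence; lra.
Qed.

(* The equation of [J] in barycentric coordinates, see [J_spec] and [J_intro]. *)
Definition J_poly : R := (1 + a) * (2 - a) * (1 - 2 * a) - 2 * c ^ 3.

Lemma left_sub_right : left_value a b c - right_value a b c =
  18 * c * (a - b) * J_poly / ((a + 2 * b + 3 * c) * (2 * a + b)) ^ 2.
Proof.
  rewrite left_value_eq, right_value_eq by assumption; unfold J_poly, norm2.
  apply Rmult_eq_reg_r with (((a + 2 * b + 3 * c) * (2 * a + b)) ^ 2);
    [| apply pow_nonzero; nra].
  field_simplify; try lra.
  replace c with (1 - a - b) by lra; ring.
Qed.

End Maximum.

(** * Farthest points *)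

Definition to_face (w : E3) : E3 :=
  let '(u, v, r) := w in
  (circumradius * u, circumradius * v, circumradius * r).

Lemma coord_to_face (m : axis) (w : E3) :
  coord m (to_face w) = circumradius * coord m w.
Proof. destruct w as [[? ?] ?], m; reflexivity. Qed.

Lemma coord_antipode (m : axis) (q : E3) : coord m (antipode q) = - coord m q.
Proof. destruct q as [[? ?] ?], m; reflexivity. Qed.

Lemma antipode_involutive (q : E3) : antipode (antipode q) = q.
Proof.
  destruct q as [[? ?] ?]; unfold antipode; f_equal; [f_equal |]; ring.
Qed.

Lemma hull3_simplex_iff (w : E3) : hull3 e1 e2 e3 w <->
  (forall m, 0 <= coord m w) /\ coord ax1 w + coord ax2 w + coord ax3 w = 1.
Proof.
  split.
  - intros (u & v & r & Hu & Hv & Hr & Hs & ->); split;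
      [intros m; destruct m |]; simpl; lra.
  - intros [H Hs]; destruct w as [[u v] r].
    apply hull3_simplex; [apply (H ax1) | apply (H ax2) | apply (H ax3) | exact Hs].
Qed.

Lemma octant_to_face (w : E3) : hull3 e1 e2 e3 w -> octant (to_face w).
Proof.
  intros H; apply hull3_simplex_iff in H; destruct H as [H Hs].
  assert (C := circumradius_pos).
  assert (N : forall m, 0 <= coord m (to_face w))
    by (intros m; rewrite coord_to_face; apply Rmult_le_pos; [lra | apply H]).
  split; [| exact N].
  apply (octahedron_intro _ _ _ _ axes_distinct true true true); try apply N.
  rewrite !coord_to_face, <- !Rmult_plus_distr_l, Hs; ring.
Qed.

Lemma antipode_octant (q : E3) : octant q ->
  octahedron (antipode q) /\ (forall m, coord m (antipode q) <= 0).
Proof.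
  intros [Ho Hq]; split.
  - destruct q as [[? ?] ?]; unfold octahedron, antipode in *.
    rewrite !Rabs_Ropp; exact Ho.
  - intros m; rewrite coord_antipode; specialize (Hq m); lra.
Qed.

Lemma opposite_face_antipode (q : E3) :
  octahedron q -> (forall m, coord m q <= 0) ->
  exists w, hull3 e1 e2 e3 w /\ q = antipode (to_face w).
Proof.
  intros Ho Hq; assert (C := circumradius_pos).
  pose proof (face_sum (fun _ => false) _ _ _ q axes_distinct Hq Ho) as S.
  destruct q as [[u v] r]; simpl in S.
  exists (- u / circumradius, - v / circumradius, - r / circumradius); split.
  - pose proof (Hq ax1); pose proof (Hq ax2); pose proof (Hq ax3); simpl in *.
    apply hull3_simplex; try (apply Rdiv_le_0_compat; lra).
    rewrite <- S; field; lra.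
  - unfold antipode, to_face; f_equal; [f_equal |]; field; lra.
Qed.

Lemma dist3_unfolding_antipode (i j k : axis) (p w : E3) :
  distinct i j k -> hull3 e1 e2 e3 p -> hull3 e1 e2 e3 w ->
  dist3 (to_face p) (unfolding i j k (antipode (to_face w))) =
  sqrt (3 / 2 * dist_sq i j k p w).
Proof.
  intros D Hp Hw.
  destruct (antipode_octant _ (octant_to_face w Hw)) as [_ N].
  rewrite dist3_unfolding by exact D.
  rewrite !negpart_nonpos by apply N.
  rewrite !coord_antipode, !coord_to_face.
  apply hull3_simplex_iff in Hp, Hw; destruct Hp as [_ Hp], Hw as [_ Hw].
  assert (Sp : coord j p = 1 - coord i p - coord k p)
    by (destruct D as (D1 & D2 & D3); destruct i, j, k; try congruence; lra).
  assert (Sw : coord j w = 1 - coord i w - coord k w)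
    by (destruct D as (D1 & D2 & D3); destruct i, j, k; try congruence; lra).
  f_equal; rewrite <- circumradius_sqr; unfold dist_sq; rewrite Sp, Sw; ring.
Qed.

Lemma dist3_lerp_le (p q r : E3) (t : R) : 0 <= t <= 1 ->
  dist3 p (lerp q r t) <= (1 - t) * dist3 p q + t * dist3 p r.
Proof.
  intros Ht.
  replace ((1 - t) * dist3 p q) with (dist3 (lerp p r t) (lerp q r t)).
  - rewrite <- (lerp_0 p r) at 1.
    apply Rle_trans with (1 := dist3_triangle _ (lerp p r t) _).
    rewrite dist3_lerp by lra; lra.
  - rewrite !(dist3_coord _ _ _ _ _ axes_distinct), !coord_lerp.
    rewrite <- (sqrt_Rsqr (1 - t)) by lra.
    rewrite <- sqrt_mult_alt by apply Rle_0_sqr.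
    f_equal; unfold Rsqr; ring.
Qed.

(** Both points have squared norm at most [3 / 2], and their inner product is nonnegative. *)
Lemma octant_diameter (p q : E3) : octant p -> octant q ->
  dist3 p q <= sqrt 3.
Proof.
  intros Hp Hq; rewrite (dist3_coord _ _ _ _ _ axes_distinct).
  pose proof (octant_sum _ _ _ p axes_distinct Hp) as Sp.
  pose proof (octant_sum _ _ _ q axes_distinct Hq) as Sq.
  destruct Hp as [_ Hp], Hq as [_ Hq]; apply sqrt_le_1_alt.
  pose proof (Hp ax1); pose proof (Hp ax2); pose proof (Hp ax3).
  pose proof (Hq ax1); pose proof (Hq ax2); pose proof (Hq ax3).
  assert (C := circumradius_sqr).
  assert (A : forall u v r, 0 <= u -> 0 <= v -> 0 <= r ->
            u + v + r = circumradius -> u ^ 2 + v ^ 2 + r ^ 2 <= 3 / 2).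
  { intros u v r U V S E; rewrite <- C, <- E.
    pose proof (Rmult_le_pos _ _ U V); pose proof (Rmult_le_pos _ _ U S);
      pose proof (Rmult_le_pos _ _ V S); lra. }
  pose proof (A _ _ _ (Hp ax1) (Hp ax2) (Hp ax3) Sp).
  pose proof (A _ _ _ (Hq ax1) (Hq ax2) (Hq ax3) Sq).
  assert (P1 : 0 <= coord ax1 p * coord ax1 q) by (apply Rmult_le_pos; auto).
  assert (P2 : 0 <= coord ax2 p * coord ax2 q) by (apply Rmult_le_pos; auto).
  assert (P3 : 0 <= coord ax3 p * coord ax3 q) by (apply Rmult_le_pos; auto).
  lra.
Qed.

(* A point outside the opposite face is a convex combination, within its face,
   of a point of the opposite face and of a point of the first face. *)
Lemma dX_outside_opposite_face (p q : E3) (V : R) :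
  octant p -> octahedron q -> (exists m, 0 < coord m q) -> sqrt 3 < V ->
  (forall q', octahedron q' -> (forall m, coord m q' <= 0) ->
     exists i j k, distinct i j k /\ dist3 p (unfolding i j k q') <= V) ->
  exists d, d < V /\ Rbar_le (dX p q) d.
Proof.
  intros Hp Oq [m0 Hm0] HV Hall; assert (C := circumradius_pos).
  set (N := - (negpart (coord ax1 q) + negpart (coord ax2 q)
               + negpart (coord ax3 q))).
  set (pos := fun x => x - negpart x).
  (* [r] is the weight of the point [e] of the first face, the rescaled positive part of [q]; the
     rescaled negative part is the point [q'] of the opposite face. *)
  set (r := (pos (coord ax1 q) + pos (coord ax2 q) + pos (coord ax3 q))
            / circumradius).
  assert (Hneg : forall x, negpart x <= 0) by (intros; apply Rmin_r).
  assert (Hpos : forall x, 0 <= pos x)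
    by (intros x; unfold pos, negpart, Rmin; destruct Rle_dec; lra).
  assert (Habs : forall x, Rabs x = pos x - negpart x)
    by (intros x; unfold pos, negpart, Rmin, Rabs; destruct Rle_dec, Rcase_abs; lra).
  assert (S : circumradius * r + N = circumradius).
  { pose proof Oq as S; apply (octahedron_coord _ _ _ _ axes_distinct) in S.
    rewrite !Habs in S; rewrite <- S at 2; unfold N, r; field; lra. }
  assert (Hr : 0 < r).
  { apply Rdiv_lt_0_compat; [| exact C].
    assert (0 < pos (coord m0 q))
      by (unfold pos; rewrite negpart_nonneg; lra).
    pose proof (Hpos (coord ax1 q)); pose proof (Hpos (coord ax2 q));
      pose proof (Hpos (coord ax3 q)); destruct m0; lra. }
  set (f := fun m => if Rle_dec 0 (coord m q) then true else false).
  assert (Fq : face f q)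
    by (intros m; unfold f; destruct (Rle_dec 0 (coord m q)); lra).
  set (e := place ax1 ax2 ax3 (pos (coord ax1 q) / r) (pos (coord ax2 q) / r)
              (pos (coord ax3 q) / r)).
  assert (Ee : forall m, coord m e = pos (coord m q) / r)
    by (intros m; destruct m; reflexivity).
  assert (Pe : forall m, 0 <= coord m e)
    by (intros m; rewrite Ee; apply Rdiv_le_0_compat; auto).
  assert (Oe : octant e).
  { split; [| exact Pe].
    apply (octahedron_intro _ _ _ _ axes_distinct true true true); try apply Pe.
    rewrite !Ee; unfold r; field; split; [lra |].
    intros Z; revert Hr; unfold r; rewrite Z; unfold Rdiv; lra. }
  assert (HN : 0 <= N).
  { unfold N; pose proof (Hneg (coord ax1 q)); pose proof (Hneg (coord ax2 q));
      pose proof (Hneg (coord ax3 q)); lra. }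
  destruct HN as [HN | HN].
  - assert (Hr1 : r < 1) by nra.
    set (q' := place ax1 ax2 ax3 (negpart (coord ax1 q) / (1 - r))
             (negpart (coord ax2 q) / (1 - r)) (negpart (coord ax3 q) / (1 - r))).
    assert (Eq' : forall m, coord m q' = negpart (coord m q) / (1 - r))
      by (intros m; destruct m; reflexivity).
    assert (Nq' : forall m, coord m q' <= 0).
    { intros m; rewrite Eq'; apply Rle_div_l; [lra |].
      rewrite Rmult_0_l; apply Hneg. }
    assert (Oq' : octahedron q').
    { apply (octahedron_intro _ _ _ _ axes_distinct false false false);
        try apply Nq'.
      rewrite !Eq'.
      transitivity (N / (1 - r)); [unfold N; field; lra |].
      replace N with (circumradius * (1 - r)) by lra; field; lra. }
    assert (Fq' : face f q').
    { intros m; unfold f; destruct (Rle_dec 0 (coord m q)) as [Z | Z];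
        [| apply Nq'].
      rewrite Eq', negpart_nonneg by exact Z; unfold Rdiv; lra. }
    destruct (Hall q' Oq' Nq') as (i0 & j0 & k0 & D0 & H0).
    (* The order supplied for [q'] need not be compatible with the face of [q]. The switch makes it
       so at no cost, and on this face the unfolding is affine. *)
    destruct (unfolding_switch f (fun _ => false) i0 j0 k0 p q')
      as (i & j & k & D & Hroll & H); auto; [split; discriminate |].
    exists ((1 - r) * V + r * sqrt 3); split; [nra |].
    apply Rbar_le_trans with (1 := dX_le_unfolding f i j k p q D Hp Oq Fq Hroll).
    simpl.
    replace (unfolding i j k q) with (lerp (unfolding i j k q') e r).
    + apply Rle_trans with (1 := dist3_lerp_le p _ e r ltac:(lra)).
      pose proof (octant_diameter p e Hp Oe); nra.
    + assert (Q : forall m, coord m q = (1 - r) * coord m q' + r * coord m e)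
        by (intros m; rewrite Ee, Eq'; unfold pos; field; lra).
      assert (Q' : forall m, negpart (coord m q) = (1 - r) * coord m q')
        by (intros m; rewrite Eq'; field; lra).
      destruct (coord_unfolding i j k q D) as (U1 & U2 & U3).
      destruct (coord_unfolding i j k q' D) as (W1 & W2 & W3).
      apply (coord_ext _ _ i j k D); rewrite coord_lerp;
        rewrite ?U1, ?U2, ?U3, ?W1, ?W2, ?W3, ?Q';
        rewrite !(negpart_nonpos (coord _ q')) by apply Nq';
        rewrite Q; ring.
  - assert (Hall0 : forall m, 0 <= coord m q).
    { intros m; pose proof (Hneg (coord ax1 q)); pose proof (Hneg (coord ax2 q));
        pose proof (Hneg (coord ax3 q)).
      assert (Z : negpart (coord m q) = 0) by (unfold N in HN; destruct m; lra).
      rewrite <- Z; apply Rmin_l. }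
    exists (sqrt 3); split; [exact HV |].
    apply Rbar_le_trans with (dist3 p q).
    + apply reach_dX, reach_same_face; [apply Hp | exact Oq |].
      intros m; apply Rmult_le_pos; [apply Hp | apply Hall0].
    + apply octant_diameter; [exact Hp | split; assumption].
Qed.

Lemma sqrt_value_le (u v : R) : 0 <= v ->
  sqrt (3 / 2 * u) <= sqrt (3 / 2 * v) -> u <= v.
Proof.
  intros Hu H; apply Rnot_lt_le; intros Hlt.
  assert (sqrt (3 / 2 * v) < sqrt (3 / 2 * u)); [| lra].
  apply sqrt_lt_1_alt; lra.
Qed.

Section Farthest.

Variables a b c : R.
Hypotheses (Hc : 0 <= c) (Hbc : c <= b) (Hab : b <= a) (Hs : a + b + c = 1).

Lemma bary_hull : hull3 e1 e2 e3 (a, b, c).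
Proof. apply hull3_simplex; lra. Qed.

Lemma left_hull : hull3 e1 e2 e3 (left_max a b c).
Proof.
  rewrite left_max_shift by assumption.
  destruct (left_shift_bounds a b c) as [H0 H1]; try assumption.
  apply hull3_simplex; lra.
Qed.

Lemma right_hull : hull3 e1 e2 e3 (right_max a b c).
Proof. apply right_max_hull; assumption. Qed.

Let P : E3 := to_face (a, b, c).
Let QL : E3 := antipode (to_face (left_max a b c)).
Let QR : E3 := antipode (to_face (right_max a b c)).
Let M : R := max_value a b c.

Lemma dX_opposite_le (i j k : axis) (w : E3) : distinct i j k ->
  hull3 e1 e2 e3 w ->
  Rbar_le (dX P (antipode (to_face w)))
          (sqrt (3 / 2 * dist_sq i j k (a, b, c) w)).
Proof.
  intros D Hw; rewrite <- dist3_unfolding_antipode by (auto using bary_hull).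
  destruct (antipode_octant _ (octant_to_face w Hw)) as [O N].
  apply (dX_le_unfolding (fun _ => false)); auto.
  - apply octant_to_face, bary_hull.
  - split; discriminate.
Qed.

Lemma dX_opposite_ge (m : R) (w : E3) : hull3 e1 e2 e3 w ->
  (forall i j k, distinct i j k -> m <= dist_sq i j k (a, b, c) w) ->
  Rbar_le (sqrt (3 / 2 * m)) (dX P (antipode (to_face w))).
Proof.
  intros Hw Hm.
  destruct (antipode_octant _ (octant_to_face w Hw)) as [O N].
  apply dX_ge_unfolding; auto.
  - apply octant_to_face, bary_hull.
  - intros i j k D; unfold P; rewrite dist3_unfolding_antipode by (auto using bary_hull).
    apply sqrt_le_1_alt; specialize (Hm i j k D); lra.
Qed.

Lemma dX_left : dX P QL = sqrt (3 / 2 * left_value a b c).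
Proof.
  apply Rbar_le_antisym.
  - rewrite <- (proj1 (dist_sq_left_max a b c Hc Hbc Hab Hs)).
    apply dX_opposite_le; [repeat split; discriminate | apply left_hull].
  - apply dX_opposite_ge; [apply left_hull |].
    intros; apply left_value_min; assumption.
Qed.

Lemma dX_right : dX P QR = sqrt (3 / 2 * right_value a b c).
Proof.
  apply Rbar_le_antisym.
  - rewrite <- (proj1 (dist_sq_right_max a b c Hc Hbc Hab Hs)).
    apply dX_opposite_le; [repeat split; discriminate | apply right_hull].
  - apply dX_opposite_ge; [apply right_hull |].
    intros; apply right_value_min; assumption.
Qed.

(** With the factor [3 / 2] the squared distance is at least 6, whereas a face has squared diameter
    3. *)
Lemma right_value_ge_4 : 4 <= right_value a b c.
Proof.
  apply le_right_value; auto.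
  replace 4 with (4 * (a + b + c) ^ 2) by (rewrite Hs; ring).
  apply Rminus_le_0; unfold norm2; clear Hs.
  ordered_positivity a b c.
Qed.

Lemma left_value_pos : 0 <= left_value a b c.
Proof.
  destruct (dist_sq_left_max a b c) as [<- _]; auto.
  unfold dist_sq; repeat apply Rplus_le_le_0_compat; apply pow2_ge_0.
Qed.

Lemma dX_opposite_cases (w : E3) : hull3 e1 e2 e3 w ->
  w = left_max a b c \/ w = right_max a b c \/
  exists d, d < sqrt (3 / 2 * M) /\ Rbar_le (dX P (antipode (to_face w))) d.
Proof.
  intros Hw.
  destruct (simplex_below a b c Hc Hbc Hab Hs w Hw) as [H | [H | H]]; auto.
  destruct H as (i & j & k & D & H); right; right.
  exists (sqrt (3 / 2 * dist_sq i j k (a, b, c) w)); split.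
  - apply sqrt_lt_1_alt; split; [| fold M in H; lra].
    apply Rmult_le_pos; [lra |].
    unfold dist_sq; repeat apply Rplus_le_le_0_compat; apply pow2_ge_0.
  - apply dX_opposite_le; assumption.
Qed.

Lemma dX_cases (q : E3) : octahedron q -> q = QL \/ q = QR \/
  exists d, d < sqrt (3 / 2 * M) /\ Rbar_le (dX P q) d.
Proof.
  intros Oq.
  destruct (Classical_Prop.classic (exists m, 0 < coord m q)) as [H | H].
  - right; right; apply dX_outside_opposite_face; auto.
    + apply octant_to_face, bary_hull.
    + apply sqrt_lt_1_alt; pose proof right_value_ge_4.
      pose proof (right_value_le_max a b c Hc Hbc Hab Hs); unfold M; lra.
    + intros q' O' N'.
      destruct (opposite_face_antipode q' O' N') as (w & Hw & ->).
      assert (B : exists i j k, distinct i j k /\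
                    dist_sq i j k (a, b, c) w <= M).
      { destruct (simplex_below a b c Hc Hbc Hab Hs w Hw)
          as [-> | [-> | (i & j & k & D & B)]].
        - exists ax3, ax2, ax1; split; [repeat split; discriminate |].
          destruct (dist_sq_left_max a b c) as [-> _]; auto.
          apply left_value_le_max; auto.
        - exists ax1, ax2, ax3; split; [repeat split; discriminate |].
          destruct (dist_sq_right_max a b c) as [-> _]; auto.
          apply right_value_le_max; auto.
        - exists i, j, k; split; [exact D |]; unfold M; lra. }
      destruct B as (i & j & k & D & B); exists i, j, k; split; [exact D |].
      unfold P; rewrite dist3_unfolding_antipode by (auto using bary_hull).
      apply sqrt_le_1_alt; lra.
  - destruct (opposite_face_antipode q Oq) as (w & Hw & ->).
    + intros m; apply Rnot_lt_le; intros Hm; apply H; exists m; exact Hm.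
    + destruct (dX_opposite_cases w Hw) as [-> | [-> | B]]; auto.
Qed.

(** By [dX_cases] all other points are strictly nearer than the better candidate, so only the two
    exact distances have to be compared. *)
Lemma farthest_iff (q : E3) : farthest P q <->
  (q = QL /\ right_value a b c <= left_value a b c) \/
  (q = QR /\ left_value a b c <= right_value a b c).
Proof.
  assert (OL : octahedron QL)
    by (apply antipode_octant, octant_to_face, left_hull).
  assert (OR : octahedron QR)
    by (apply antipode_octant, octant_to_face, right_hull).
  pose proof left_value_pos as PL; pose proof right_value_ge_4 as PR.
  assert (UL : sqrt (3 / 2 * left_value a b c) <= sqrt (3 / 2 * M)).
  { apply sqrt_le_1_alt; pose proof (left_value_le_max a b c Hc Hbc Hab Hs);
      unfold M; lra. }
  assert (UR : sqrt (3 / 2 * right_value a b c) <= sqrt (3 / 2 * M)).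
  { apply sqrt_le_1_alt; pose proof (right_value_le_max a b c Hc Hbc Hab Hs);
      unfold M; lra. }
  split.
  - intros [Oq Hq].
    pose proof (Hq QL OL) as HL; pose proof (Hq QR OR) as HR.
    rewrite dX_left in HL; rewrite dX_right in HR.
    destruct (dX_cases q Oq) as [-> | [-> | (d & Hd & B)]].
    + left; split; [reflexivity |].
      rewrite dX_left in HR; apply sqrt_value_le; [lra | exact HR].
    + right; split; [reflexivity |].
      rewrite dX_right in HL; apply sqrt_value_le; [lra | exact HL].
    + exfalso.
      apply (Rbar_le_trans _ _ _ HL) in B as BL.
      apply (Rbar_le_trans _ _ _ HR) in B as BR.
      simpl in BL, BR; revert Hd; unfold M, max_value, Rmax.
      destruct Rle_dec; lra.
  - intros H.
    assert (Hmax : octahedron q /\ Rbar_le (sqrt (3 / 2 * M)) (dX P q)).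
    { destruct H as [[-> H] | [-> H]].
      - split; [exact OL |].
        rewrite dX_left; apply sqrt_le_1_alt; unfold M, max_value.
        rewrite Rmax_left by exact H; lra.
      - split; [exact OR |].
        rewrite dX_right; apply sqrt_le_1_alt; unfold M, max_value.
        rewrite Rmax_right by exact H; lra. }
    destruct Hmax as [Oq Hmax]; split; [exact Oq |].
    intros q' Oq'; apply Rbar_le_trans with (2 := Hmax).
    destruct (dX_cases q' Oq') as [-> | [-> | (d & Hd & B)]].
    + rewrite dX_left; exact UL.
    + rewrite dX_right; exact UR.
    + apply Rbar_le_trans with (1 := B); simpl; lra.
Qed.

Lemma left_eq_right : c * (a - b) = 0 ->
  left_max a b c = (a, b, c) /\ right_max a b c = (a, b, c).
Proof.
  intros H; rewrite left_max_shift, right_max_shift by assumption.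
  unfold left_shift, right_shift; rewrite !Rmult_assoc, H, Rmult_0_r.
  unfold Rdiv; rewrite !Rmult_0_l; split; f_equal; try f_equal; ring.
Qed.

Lemma left_right_values :
  (0 <= J_poly a c -> right_value a b c <= left_value a b c) /\
  (J_poly a c <= 0 -> left_value a b c <= right_value a b c) /\
  (J_poly a c <> 0 -> left_value a b c = right_value a b c -> c * (a - b) = 0).
Proof.
  pose proof (left_sub_right a b c Hc Hbc Hab Hs) as E.
  set (d := ((a + 2 * b + 3 * c) * (2 * a + b)) ^ 2) in E.
  assert (Hd : 0 < / d) by (apply Rinv_0_lt_compat, pow_lt; nra).
  assert (H0 : 0 <= c * (a - b)) by (apply Rmult_le_pos; lra).
  assert (E' : left_value a b c - right_value a b c =
    18 * / d * (c * (a - b)) * J_poly a c) by (rewrite E; unfold Rdiv; ring).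
  assert (H1 : 0 <= 18 * / d * (c * (a - b)))
    by (repeat apply Rmult_le_pos; lra).
  split; [| split].
  - intros H; pose proof (Rmult_le_pos _ _ H1 H); lra.
  - intros H; assert (0 <= 18 * / d * (c * (a - b)) * - J_poly a c)
      by (apply Rmult_le_pos; lra); lra.
  - intros H H2; rewrite H2, Rminus_diag in E'.
    symmetry in E'; apply Rmult_integral in E'; destruct E' as [E' | E'];
      [| contradiction].
    apply Rmult_integral in E'; destruct E' as [E' | E']; [lra | exact E'].
Qed.

Lemma farthest_left : 0 < J_poly a c -> forall q, farthest P q <-> q = QL.
Proof.
  intros H q; rewrite farthest_iff.
  destruct left_right_values as (H1 & H2 & H3).
  assert (A : right_value a b c <= left_value a b c) by (apply H1; lra).
  split; [| auto].
  intros [[-> _] | [-> B]]; [reflexivity |].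
  (* A tie with [J_poly] nonzero forces [c * (a - b) = 0], and then the two candidates are one
     point. *)
  destruct (left_eq_right (H3 ltac:(lra) ltac:(lra))) as [E1 E2].
  unfold QL, QR; rewrite E1, E2; reflexivity.
Qed.

Lemma farthest_right : J_poly a c < 0 -> forall q, farthest P q <-> q = QR.
Proof.
  intros H q; rewrite farthest_iff.
  destruct left_right_values as (H1 & H2 & H3).
  assert (A : left_value a b c <= right_value a b c) by (apply H2; lra).
  split; [| auto].
  intros [[-> B] | [-> _]]; [| reflexivity].
  destruct (left_eq_right (H3 ltac:(lra) ltac:(lra))) as [E1 E2].
  unfold QL, QR; rewrite E1, E2; reflexivity.
Qed.

Lemma farthest_both : J_poly a c = 0 ->
  forall q, farthest P q <-> q = QL \/ q = QR.
Proof.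
  intros H q; rewrite farthest_iff.
  destruct left_right_values as (H1 & H2 & H3).
  assert (right_value a b c <= left_value a b c) by (apply H1; lra).
  assert (left_value a b c <= right_value a b c) by (apply H2; lra).
  intuition.
Qed.

End Farthest.

(** * The planar chart *)

Definition bary1 (x : R) : R := (1 + 2 * x) / 3.
Definition bary2 (x y : R) : R := (1 - x + sqrt 3 * y) / 3.
Definition bary3 (x y : R) : R := (1 - x - sqrt 3 * y) / 3.

Lemma chart_bary (x y : R) :
  chart (x, y) = to_face (bary1 x, bary2 x y, bary3 x y).
Proof. reflexivity. Qed.

Lemma sqrt3_pos : 0 < sqrt 3.
Proof. apply sqrt_lt_R0; lra. Qed.

Lemma bary_sum (x y : R) : bary1 x + bary2 x y + bary3 x y = 1.
Proof. unfold bary1, bary2, bary3; field. Qed.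

(** The fundamental chamber in barycentric coordinates; it contains [T] by [T_ordered] and [J] by
    [J_spec]. *)
Definition ordered (x y : R) : Prop :=
  0 <= bary3 x y /\ bary3 x y <= bary2 x y /\ bary2 x y <= bary1 x.

Lemma T_ordered (x y : R) : T (x, y) -> ordered x y.
Proof.
  intros (u & v & r & Hu & Hv & Hr & Hs & E); simpl in E.
  injection E; intros Ey Ex; clear E.
  assert (Sy : sqrt 3 * y = 3 / 4 * r).
  { rewrite Ey; transitivity (sqrt 3 * sqrt 3 * r / 4); [field |].
    rewrite sqrt3_sqr; field. }
  unfold ordered, bary1, bary2, bary3; rewrite Sy, Ex; lra.
Qed.

Lemma cube_le (u v : R) : 0 <= v -> u ^ 3 <= v ^ 3 -> u <= v.
Proof.
  intros Hv H; apply Rnot_lt_le; intros Hlt.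
  assert (0 < (u - v) * (u ^ 2 + u * v + v ^ 2)); [| lra].
  assert (0 < u * u) by (apply Rmult_lt_0_compat; lra).
  assert (0 <= u * v) by (apply Rmult_le_pos; lra).
  assert (0 <= v * v) by (apply Rmult_le_pos; lra).
  apply Rmult_lt_0_compat; lra.
Qed.

Lemma cube_root (u : R) : 0 < u ->
  0 < Rpower u (1 / 3) /\ Rpower u (1 / 3) ^ 3 = u.
Proof.
  intros Hu; assert (P : 0 < Rpower u (1 / 3)) by apply exp_pos.
  split; [exact P |].
  rewrite <- Rpower_pow by exact P; rewrite Rpower_mult.
  replace (1 / 3 * INR 3) with 1 by (simpl; field).
  apply Rpower_1; exact Hu.
Qed.

(* [4 + u + v - (u^2 + u v + v^2)] is the opposite of the slope of the cubic
   polynomial between [u] and [v]. *)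
Lemma J_root_slope (u v : R) : 0 <= u <= 1 -> 0 <= v <= 1 ->
  0 < 4 + u + v - (u ^ 2 + u * v + v ^ 2).
Proof. intros; nra. Qed.

Lemma J_root_poly_nonpos (x : R) : J_root <= x < 1 / 4 ->
  x ^ 3 - x ^ 2 - 4 * x + 1 <= 0.
Proof.
  intros Hx; destruct J_root_spec as [Hr E].
  pose proof (J_root_slope x J_root ltac:(lra) ltac:(lra)) as S.
  assert (0 <= (x - J_root) *
    (4 + x + J_root - (x ^ 2 + x * J_root + J_root ^ 2)))
    by (apply Rmult_le_pos; lra).
  lra.
Qed.

Lemma J_root_le (x : R) : 0 <= x < 1 ->
  x ^ 3 - x ^ 2 - 4 * x + 1 <= 0 -> J_root <= x.
Proof.
  intros Hx H; destruct J_root_spec as [Hr E].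
  apply Rnot_lt_le; intros Hlt.
  pose proof (J_root_slope x J_root ltac:(lra) ltac:(lra)) as S.
  assert (0 < (J_root - x) *
    (4 + x + J_root - (x ^ 2 + x * J_root + J_root ^ 2)))
    by (apply Rmult_lt_0_compat; lra).
  lra.
Qed.

Lemma J_spec (x y : R) : J (x, y) ->
  ordered x y /\ 0 < bary3 x y /\ J_poly (bary1 x) (bary3 x y) = 0 /\
  0 < x < 1 / 4.
Proof.
  intros [Hx Hy]; simpl in Hx, Hy.
  pose proof (J_root_poly_nonpos x Hx) as HP.
  destruct J_root_spec as [Hr _].
  set (u := (2 + x) * (5 - 2 * x) * (1 - 4 * x)).
  assert (Hu : 0 < u)
    by (unfold u; repeat apply Rmult_lt_0_compat; lra).
  destruct (cube_root u Hu) as [Pr Er].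
  unfold J_fun in Hy; fold u in Hy; set (r := Rpower u (1 / 3)) in *.
  assert (Sy : sqrt 3 * y = 1 - x - r).
  { rewrite Hy; field; pose proof sqrt3_pos; lra. }
  (* [(1 - x) ^ 3 - u] is -9 times the cubic that defines [J_root], so this bound, which says that
     [y] is nonnegative, is the condition [J_root <= x]. *)
  assert (H1 : r <= 1 - x) by (apply cube_le; [lra |]; rewrite Er; unfold u; lra).
  assert (H2 : 1 - 4 * x <= r).
  { apply cube_le; [lra |]; rewrite Er; unfold u.
    assert (0 <= (1 - 4 * x) * ((2 + x) * (5 - 2 * x) - (1 - 4 * x) ^ 2))
      by (apply Rmult_le_pos; nra).
    lra. }
  assert (E3 : bary3 x y = r / 3) by (unfold bary3; lra).
  unfold ordered; rewrite E3; unfold bary1, bary2, J_poly.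
  repeat split; try lra.
  replace (2 * (r / 3) ^ 3) with (2 / 27 * r ^ 3) by field.
  rewrite Er; unfold u; field.
Qed.

Lemma J_intro (x y : R) : ordered x y -> 0 < bary3 x y ->
  J_poly (bary1 x) (bary3 x y) = 0 -> J (x, y).
Proof.
  intros (H3 & H32 & H21) Pc E.
  unfold ordered, bary1, bary2, bary3, J_poly in *.
  set (s := sqrt 3 * y) in *.
  assert (Ec : (1 - x - s) ^ 3 = (2 + x) * (5 - 2 * x) * (1 - 4 * x)) by lra.
  assert (Pc3 : 0 < (1 - x - s) ^ 3) by (apply pow_lt; lra).
  assert (Hx : 0 <= x) by lra.
  assert (Hx1 : x < 1 / 4).
  { apply Rnot_le_lt; intros H.
    assert (0 <= (2 + x) * (5 - 2 * x) * (4 * x - 1)); [| lra].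
    repeat apply Rmult_le_pos; lra. }
  assert (Hs : (1 - x - s) ^ 3 <= (1 - x) ^ 3) by (apply pow_incr; lra).
  split; simpl.
  - split; [| exact Hx1]; apply J_root_le; lra.
  - unfold J_fun; rewrite <- Ec, <- Rpower_pow by lra.
    rewrite Rpower_mult; replace (INR 3 * (1 / 3)) with 1 by (simpl; field).
    rewrite Rpower_1 by lra; unfold s; field.
    pose proof sqrt3_pos; lra.
Qed.

(** This turns left and right of [J] into the sign of [J_poly]. At constant height an increase of
    [a] by [h] lowers [c] by [h / 2]. *)
Lemma J_poly_decreasing (x x' y : R) : ordered x y -> ordered x' y -> x < x' ->
  J_poly (bary1 x') (bary3 x' y) < J_poly (bary1 x) (bary3 x y).
Proof.
  intros H H' Hlt; unfold ordered in *.
  pose proof (bary_sum x y); pose proof (bary_sum x' y).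
  set (h := bary1 x' - bary1 x).
  assert (Hh : 0 < h) by (unfold h, bary1; lra).
  assert (E1 : bary1 x = bary1 x' - h) by (unfold h; ring).
  assert (E3 : bary3 x y = bary3 x' y + h / 2)
    by (unfold h, bary1, bary3; field).
  revert H H' H0 H1; rewrite E1, E3.
  generalize (bary1 x') (bary3 x' y) (bary2 x y) (bary2 x' y).
  clearbody h; intros a c b b' H H' S S'; unfold J_poly.
  (* The factor after [h] is the difference quotient; it is positive because [a] and [a - h] lie
     between 0 and 1, and [c] and [c + h / 2], being least coordinates, are at most [1 / 3]. *)
  assert (0 < h * (3 + 3 * (2 * a - h) - 2 * (a ^ 2 + a * (a - h) + (a - h) ^ 2)
    - (c ^ 2 + c * (c + h / 2) + (c + h / 2) ^ 2))); [| lra].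
  apply Rmult_lt_0_compat; [exact Hh |].
  assert (0 <= a * (1 - a)) by (apply Rmult_le_pos; lra).
  assert (0 <= (a - h) * (1 - (a - h))) by (apply Rmult_le_pos; lra).
  assert (c ^ 2 <= 1 / 9) by nra.
  assert ((c + h / 2) ^ 2 <= 1 / 9) by nra.
  assert (0 <= h ^ 2) by nra.
  assert (0 <= (c - (c + h / 2)) ^ 2) by nra.
  lra.
Qed.

Lemma left_formula_chart (x y : R) : ordered x y ->
  chart (left_formula (x, y)) =
  to_face (left_max (bary1 x) (bary2 x y) (bary3 x y)).
Proof.
  intros (H3 & H32 & H21); pose proof (bary_sum x y) as S.
  rewrite left_max_shift by assumption.
  unfold left_shift; unfold left_formula; rewrite chart_bary.
  pose proof sqrt3_pos as P3; pose proof sqrt3_sqr as S3.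
  set (s := sqrt 3) in *.
  (* In terms of [h] the square root disappears: the last two coordinates are [(1 - x) / 3 + h] and
     [(1 - x) / 3 - h]. *)
  set (h := y / s).
  assert (Ey : y = s * h) by (unfold h; field; lra).
  assert (Eb : bary2 x y = (1 - x) / 3 + h)
    by (unfold bary2; fold s; rewrite Ey, <- Rmult_assoc, S3; field).
  assert (Ec : bary3 x y = (1 - x) / 3 - h)
    by (unfold bary3; fold s; rewrite Ey, <- Rmult_assoc, S3; field).
  rewrite Eb, Ec in *; unfold bary1 in *.
  assert (D : x + h - 2 < 0) by lra.
  replace ((- x * y - s * x + s * y ^ 2 - y) / (s * x + y - 2 * s))
    with ((- x * h - x + 3 * h ^ 2 - h) / (x + h - 2)).
  2: { rewrite Ey; rewrite <- S3; field; split; [| lra].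
       replace (s * x + s * h - 2 * s) with (s * (x + h - 2)) by ring.
       apply Rmult_integral_contrapositive_currified; lra. }
  unfold bary2, bary3; fold s.
  replace (s * y) with (3 * h) by (rewrite Ey, <- Rmult_assoc, S3; ring).
  f_equal; f_equal; [f_equal |]; field; lra.
Qed.

Lemma right_formula_chart (x y : R) : ordered x y ->
  chart (right_formula (x, y)) =
  to_face (right_max (bary1 x) (bary2 x y) (bary3 x y)).
Proof.
  intros (H3 & H32 & H21); pose proof (bary_sum x y) as S.
  rewrite right_max_shift by assumption.
  unfold right_shift; unfold right_formula; rewrite chart_bary.
  pose proof sqrt3_pos as P3; pose proof sqrt3_sqr as S3.
  set (s := sqrt 3) in *.
  set (h := y / s).
  assert (Ey : y = s * h) by (unfold h; field; lra).
  assert (Eb : bary2 x y = (1 - x) / 3 + h)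
    by (unfold bary2; fold s; rewrite Ey, <- Rmult_assoc, S3; field).
  assert (Ec : bary3 x y = (1 - x) / 3 - h)
    by (unfold bary3; fold s; rewrite Ey, <- Rmult_assoc, S3; field).
  rewrite Eb, Ec in *; unfold bary1 in *.
  assert (D : 0 < x + h + 1) by lra.
  replace ((- x * y + 2 * s * x + s * y ^ 2 - y) / (s * x + y + s))
    with ((- x * h + 2 * x + 3 * h ^ 2 - h) / (x + h + 1)).
  2: { rewrite Ey; rewrite <- S3; field; split; [| lra].
       replace (s * x + s * h + s) with (s * (x + h + 1)) by ring.
       apply Rmult_integral_contrapositive_currified; lra. }
  unfold bary2, bary3; fold s.
  replace (s * y) with (3 * h) by (rewrite Ey, <- Rmult_assoc, S3; ring).
  f_equal; f_equal; [f_equal |]; field; lra.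
Qed.

Lemma left_formula_moebius (p : R * R) : left_formula p = left_moebius p.
Proof.
  destruct p as [x y]; unfold left_formula, left_moebius, coefA, coefB, coefC,
    coefD; f_equal; f_equal; ring.
Qed.

Lemma right_formula_moebius (p : R * R) : right_formula p = right_moebius p.
Proof.
  destruct p as [x y]; unfold right_formula, right_moebius, coefA, coefB, coefC,
    coefD; f_equal.
  replace ((y - 2 * sqrt 3) * x - (sqrt 3 * y ^ 2 - y)) with
    (- (- x * y + 2 * sqrt 3 * x + sqrt 3 * y ^ 2 - y)) by ring.
  replace (- sqrt 3 * x + (- y - sqrt 3)) with (- (sqrt 3 * x + y + sqrt 3))
    by ring.
  rewrite Rdiv_opp_l, Rdiv_opp_r, Ropp_involutive; reflexivity.
Qed.

Lemma f_oct_eq (p q : E3) : (forall q', farthest p q' <-> q' = q) ->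
  has_unique_farthest p /\ f_oct p = antipode q.
Proof.
  intros H.
  assert (U : has_unique_farthest p).
  { exists q; split; [apply H; reflexivity |].
    intros q' Hq'; symmetry; apply H; exact Hq'. }
  split; [exact U |].
  unfold f_oct; f_equal; apply H, F_oct_spec; exact U.
Qed.

Lemma f_oct_left (x y : R) : ordered x y ->
  0 < J_poly (bary1 x) (bary3 x y) ->
  has_unique_farthest (chart (x, y)) /\
  f_oct (chart (x, y)) = chart (left_formula (x, y)).
Proof.
  intros H HJ; rewrite left_formula_chart by exact H.
  destruct H as (H3 & H32 & H21).
  rewrite <- (antipode_involutive (to_face _)).
  apply f_oct_eq; apply farthest_left; auto using bary_sum.
Qed.

Lemma f_oct_right (x y : R) : ordered x y ->
  J_poly (bary1 x) (bary3 x y) < 0 ->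
  has_unique_farthest (chart (x, y)) /\
  f_oct (chart (x, y)) = chart (right_formula (x, y)).
Proof.
  intros H HJ; rewrite right_formula_chart by exact H.
  destruct H as (H3 & H32 & H21).
  rewrite <- (antipode_involutive (to_face _)).
  apply f_oct_eq; apply farthest_right; auto using bary_sum.
Qed.

(** The hypotheses force [a = b = 1 / 2], the top vertex. The values tie there, but both candidates
    are the antipode of the point since [c = 0]. *)
Lemma f_oct_top (x y : R) : ordered x y -> bary3 x y = 0 ->
  J_poly (bary1 x) (bary3 x y) = 0 ->
  has_unique_farthest (chart (x, y)) /\
  f_oct (chart (x, y)) = chart (x, y).
Proof.
  intros (H3 & H32 & H21) E HJ.
  rewrite <- (antipode_involutive (chart (x, y))) at 3.
  apply f_oct_eq; intros q; rewrite chart_bary.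
  pose proof (bary_sum x y) as S.
  rewrite farthest_both by auto.
  destruct (left_eq_right (bary1 x) (bary2 x y) (bary3 x y)) as [-> ->]; auto.
  - rewrite E; ring.
  - intuition.
Qed.

Theorem theorem1p1 :
  (forall p : R * R, T p -> ~ J p -> has_unique_farthest (chart p)) /\
  (forall p : R * R, T p -> ~ J p -> left_of_J p ->
     f_oct (chart p) = chart (left_formula p) /\
     left_formula p = left_moebius p) /\
  (forall p : R * R, T p -> ~ J p -> right_of_J p ->
     f_oct (chart p) = chart (right_formula p) /\
     right_formula p = right_moebius p) /\
  f_oct (chart T_top) = chart T_top /\
  (forall p : R * R, J p ->
     left_formula p <> right_formula p /\
     (forall v : E3,
        (exists q : E3, farthest (chart p) q /\ v = antipode q) <->
        (v = chart (left_formula p) \/ v = chart (right_formula p)))).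
Proof.
  split; [| split; [| split; [| split]]].
  - intros [x y] HT HnJ; apply T_ordered in HT.
    destruct (Rtotal_order (J_poly (bary1 x) (bary3 x y)) 0) as [H | [H | H]].
    + apply f_oct_right; assumption.
    (* [J_poly] vanishes on [J] and also at the top vertex, which [J] omits; the third coordinate
       tells them apart. *)
    + destruct (Req_dec (bary3 x y) 0) as [E | E].
      * apply f_oct_top; assumption.
      * exfalso; apply HnJ, J_intro; auto.
        destruct HT as [H3 _]; lra.
    + apply f_oct_left; assumption.
  - intros [x y] HT _ (x' & HJ & Hlt); simpl in HJ, Hlt; apply T_ordered in HT.
    split; [| apply left_formula_moebius].
    apply f_oct_left; [exact HT |].
    destruct (J_spec x' y HJ) as (H' & _ & E & _); rewrite <- E.
    apply J_poly_decreasing; assumption.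
  - intros [x y] HT _ (x' & HJ & Hlt); simpl in HJ, Hlt; apply T_ordered in HT.
    split; [| apply right_formula_moebius].
    apply f_oct_right; [exact HT |].
    destruct (J_spec x' y HJ) as (H' & _ & E & _); rewrite <- E.
    apply J_poly_decreasing; assumption.
  - assert (E3 : bary3 (1 / 4) (sqrt 3 / 4) = 0).
    { unfold bary3; replace (sqrt 3 * (sqrt 3 / 4)) with (sqrt 3 * sqrt 3 / 4)
        by field; rewrite sqrt3_sqr; field. }
    assert (E2 : bary2 (1 / 4) (sqrt 3 / 4) = 1 / 2).
    { unfold bary2; replace (sqrt 3 * (sqrt 3 / 4)) with (sqrt 3 * sqrt 3 / 4)
        by field; rewrite sqrt3_sqr; field. }
    apply f_oct_top; [| exact E3 |].
    + unfold ordered; rewrite E2, E3; unfold bary1; lra.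
    + rewrite E3; unfold J_poly, bary1; field.
  - intros [x y] HJ.
    destruct (J_spec x y HJ) as (Ho & Pc & E & Hx).
    rewrite left_formula_chart, right_formula_chart by exact Ho.
    pose proof (bary_sum x y) as S.
    split.
    + intros Eq.
      assert (Eq' : coord ax1 (chart (left_formula (x, y))) =
                    coord ax1 (chart (right_formula (x, y))))
        by (rewrite Eq; reflexivity).
      rewrite left_formula_chart, right_formula_chart, !coord_to_face in Eq'
        by exact Ho.
      destruct Ho as (H3 & H32 & H21).
      rewrite left_max_shift, right_max_shift in Eq' by assumption.
      apply Rmult_eq_reg_l in Eq'; [| pose proof circumradius_pos; lra].
      simpl in Eq'; unfold left_shift, right_shift in Eq'.
      (* For [a = b] the polynomial becomes [9 * a * (1 - a) * (1 - 2 * a)], which is positive as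
         [c = 1 - 2 * a] is. So both shifts are positive, and the candidates lie on different sides
         of the point. *)
      assert (Hab : bary2 x y < bary1 x).
      { apply Rnot_le_lt; intros H.
        assert (Ea : bary3 x y = 1 - 2 * bary1 x) by lra.
        rewrite Ea in E; unfold J_poly in E.
        assert (Z : 9 * bary1 x * (1 - bary1 x) * (1 - 2 * bary1 x) = 0) by lra.
        assert (0 < bary1 x) by lra.
        assert (0 < 9 * bary1 x * (1 - bary1 x) * (1 - 2 * bary1 x)); [| lra].
        repeat apply Rmult_lt_0_compat; lra. }
      set (a := bary1 x) in *; set (b := bary2 x y) in *;
        set (c := bary3 x y) in *; clearbody a b c.
      assert (0 < 2 * c * (a - b) / (a + 2 * b + 3 * c))
        by (apply Rdiv_lt_0_compat; [| lra]; repeat apply Rmult_lt_0_compat; lra).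
      assert (0 < 2 * c * (a - b) / (2 * a + b))
        by (apply Rdiv_lt_0_compat; [| lra]; repeat apply Rmult_lt_0_compat; lra).
      lra.
    + destruct Ho as (H3 & H32 & H21); intros v; split.
      * intros (q & Hq & ->).
        rewrite chart_bary in Hq; apply farthest_both in Hq; auto.
        destruct Hq as [-> | ->]; rewrite antipode_involutive; auto.
      * intros [-> | ->];
          [exists (antipode (to_face (left_max (bary1 x) (bary2 x y) (bary3 x y))))
          |exists (antipode (to_face (right_max (bary1 x) (bary2 x y) (bary3 x y))))];
          (split; [rewrite chart_bary; apply farthest_both; auto
                  | rewrite antipode_involutive; reflexivity]).
Qed.
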